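(* For every integer $n\ge 1$ we have $$\langle \chi_{\Lambda_n},\chi_n\rangle=(-1)^s\,\frac{n!}{2^s},\qquad s=\left[\frac{n+1}{4}\right].$$ In particular, $\Lambda_n$ is $n$-universal.
   Context: A position is an ordered pair $(i,j)$ of positive integers; a pattern is a finite set of positions. $L(n)$ is the space of traceless complex $n\times n$ matrices. For a pattern $I\subseteq\{1,\dots,n\}^2$, $L_I(n)$ is the subspace of all $X=[x_{ij}]\in L(n)$ with $x_{ij}=0$ for all $(i,j)\in I$. The pattern $I$ is $n$-universal if every matrix in $L(n)$ is unitarily similar (by an element of $\mathrm{U}(n)$) to a matrix in $L_I(n)$. For a pattern $I$ put $\chi_I=\prod_{(i,j)\in I}(x_i-x_j)\in\mathbf{R}[x_1,x_2,\ldots]$, and $\chi_n=\prod_{1\le i<j\le n}(x_i-x_j)$ (empty products are 1). $\langle\cdot,\cdot\rangle$ is the inner product on the real polynomial ring $\mathbf{R}[x_1,x_2,\dots]$ for which the monomials form an orthonormal basis. $[t]$ denotes the integer part of $t$. The pattern $\Lambda_n$: write $n=4m+r$ with integers $m\ge0$ and $r\in\{0,1,2,3\}$. Then $\Lambda_n$ consists of all positions $(i,j)$ with $i,j\in\{1,\dots,n\}$, $i\ne j$ and $i+j\le n+1$, except those of the form $(2i-1,n-2i+1)$ and $(n-2i+1,2i-1)$ with $1\le i\le m$, and, if $r=2$ or $r=3$, also excepting the position $(2m+2,2m+1)$. *)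

(* Defs.v *)
(* Mathematical Components, with real closed fields, finite sets over a
   choiceType and monoid algebras. *)
From mathcomp Require Import all_boot all_order all_algebra.
From mathcomp Require Export finmap.
From mathcomp Require Export monalg.
From mathcomp Require Export complex.
From mathcomp Require Export reals.

Set Implicit Arguments.
Unset Strict Implicit.
Unset Printing Implicit Defensive.

Import Order.TTheory GRing.Theory Num.Theory.
Local Open Scope ring_scope.
Local Open Scope fset_scope.
Local Open Scope sesquilinear_scope.

(* Positions are numbered from 1; that a pattern has no zero coordinate is part
   of [in_square]. *)
Notation position := (nat * nat)%type (only parsing).
Notation pattern := {fset position} (only parsing).

Definition in_square (n : nat) (I : pattern) : Prop :=
  forall i j : nat, (i, j) \in I -> (1 <= i <= n)%N /\ (1 <= j <= n)%N.

Definition L (R : realType) (n : nat) (X : 'M[complex R]_n) : Prop :=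
  \tr X = 0.

(* The entry x_{ij} of the 1-based convention is [X (i - 1) (j - 1)]. *)
Definition L_sub (R : realType) (n : nat) (I : pattern)
    (X : 'M[complex R]_n) : Prop :=
  L X /\ forall i j : 'I_n, (i.+1, j.+1) \in I -> X i j = 0.

Definition unitarily_similar (R : realType) (n : nat)
    (X Y : 'M[complex R]_n) : Prop :=
  exists2 U : 'M[complex R]_n, U \is unitarymx & Y = U *m X *m U^t*.

Definition universal (R : realType) (n : nat) (I : pattern) : Prop :=
  in_square n I /\
  forall X : 'M[complex R]_n, L X ->
    exists2 Y : 'M[complex R]_n, L_sub I Y & unitarily_similar X Y.

(* Real polynomials in the variables x_0, x_1, x_2, ...; the variable x_0 is
   never used below. *)
Notation polyring R := {malg R[{cmonom nat}]} (only parsing).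

Definition var (R : realType) (i : nat) : polyring R := << ucm i >>.

Definition chi_pattern (R : realType) (I : pattern) : polyring R :=
  \prod_(p <- I) (var R p.1 - var R p.2).

Definition chi (R : realType) (n : nat) : polyring R :=
  \prod_(1 <= i < n.+1) \prod_(i.+1 <= j < n.+1) (var R i - var R j).

(* The bilinear form for which the monomials are orthonormal: the terms outside
   the support of [p] vanish. *)
Definition inner (R : realType) (p q : polyring R) : R :=
  \sum_(m <- msupp p) p@_m * q@_m.

(* Here [m = n %/ 4] and [r = n %% 4]; since [2 * i <= n] for [i <= m], the
   natural number subtractions are exact. *)
Definition Lambda_exceptions (n : nat) : seq position :=
  let m := (n %/ 4)%N in
  let r := (n %% 4)%N in
  [seq (2 * i - 1, n - 2 * i + 1)%N | i <- iota 1 m] ++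
  [seq (n - 2 * i + 1, 2 * i - 1)%N | i <- iota 1 m] ++
  (if (r == 2)%N || (r == 3)%N then [:: (2 * m + 2, 2 * m + 1)%N] else [::]).

Definition Lambda (n : nat) : pattern :=
  [fset p in [seq (i, j) | i <- iota 1 n, j <- iota 1 n] |
    [&& p.1 != p.2, (p.1 + p.2 <= n + 1)%N & p \notin Lambda_exceptions n]].

(* Main.v *)
Require Import Defs.
From mathcomp Require Import all_boot all_order all_algebra.
From mathcomp Require Import all_fingroup cyclic separable cyclotomic.
From mathcomp Require Import boolp classical_sets topology normedtype derive.
From mathcomp Require Import -(notations) mpoly ssrcomplements.
From HB Require Import structures.
From mathcomp Require Import ring lra zify polyrcf.

Set Implicit Arguments.
Unset Strict Implicit.
Unset Printing Implicit Defensive.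

Import Order.TTheory GRing.Theory Num.Theory.
Import numFieldNormedType.Exports.
Local Open Scope ring_scope.

(* Universality.  Write A = {1..n} x {1..n-1} and attach to the i-th row the
   coefficient vector v_i of a product of n-1 linear forms; a point of (P^1)^A
   thus yields n nonzero row vectors.  The n(n-1) equations v_i v_j^* = 0
   (i < j) and v_i X v_j^* = 0 ((i,j) in the pattern) are sections of line
   bundles on (P^1)^A whose degrees are e_i - e_j, so the product of their Chern
   classes is the permanent of the degrees, a nonzero multiple of the coefficient
   of (x_1...x_n)^(n-1) in chi_Lambda chi_n, that is, up to sign, of
   <chi_Lambda, chi_n>.  When it is nonzero there is a common zero, and the
   normalized v_i are the rows of the required unitary matrix.

   The topology is replaced by calculus with polynomial functions on products of
   unit spheres of C^2: each curvature form is cohomologous, by a polynomial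
   primitive, to a form decaying like (1 - e|F_k|^2)^K where the section F_k does
   not vanish; without common zeros the integral of the product is arbitrarily
   small, but it is a nonzero multiple of the permanent.

   Value.  A homogeneous p of degree n(n-1)/2 has alternating sum of values equal
   to <p, chi_n> chi_n(x), whence <chi_Lambda, chi_n> is the sum over all
   orderings x of n distinct numbers of chi_Lambda(x) / chi_n(x).  For the n-th
   roots of unity, removing the first two and the last two positions reduces this
   quotient for n to the one for n-4 up to a factor depending on four roots only,
   and this factor has average -1/2. *)

(** * Top-degree forms and transgression *)

(** The equations involve the conjugates of the v_j, so they are smooth but not holomorphic
    sections, of degrees of both signs: complex elimination theory does not supply a zero, and the
    Chern class argument has to be run on smooth representatives. The count is tight: n(n-1)/2
    orthogonality relations and n(n-1)/2 positions of the pattern match the n(n-1) projective lines.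
    Describing v_i by linear factors instead of a point of P^(n-1) makes the base a product of
    lines; the class t of each line satisfies t^2 = 0, so a top product of linear combinations of
    these classes is exactly a permanent.

    Lifted to the spheres everything is a polynomial in coordinates and their conjugates. Forms then
    reduce to derivations together with one linear functional, and the integral is bounded by the
    integrand at one well-chosen point.

    Roots of unity serve for two reasons: the product of the differences between one of them and all
    the others is N divided by that root, and their power sums of exponents -1, 1 and 2 vanish when
    N > 2. *)

Section Stokes.
Variables (C : numDomainType) (B : comNzRingType) (mu : {additive B -> C}).
Variable A : finType.
Let J := (A * bool)%type.
Variable X : J -> {additive B -> B}.
Hypothesis XM : forall p f g, X p (f * g) = X p f * g + f * X p g.
Hypothesis muX : forall p f, mu (X p f) = 0.

(* The value on the frame (X p)_p of the product of the 2-forms sig k, times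
   2^|A|; the derivations X p play the role of left-invariant vector fields
   and mu that of the invariant integral. *)
Definition top (sig : A -> J -> J -> B) : B :=
  \sum_(s : {perm J}) (-1) ^+ s * \prod_k sig k (s (k, false)) (s (k, true)).

Lemma deriv_one p : X p 1 = 0.
Proof.
by apply: (addrI (X p 1)); rewrite addr0 -[in RHS](mulr1 1) XM mulr1 mul1r.
Qed.

Lemma deriv_prod p (I : finType) (P : pred I) (f : I -> B) :
  X p (\prod_(k | P k) f k) =
  \sum_(j | P j) X p (f j) * \prod_(k | P k && (k != j)) f k.
Proof.
suff gen (r : seq I) : uniq r ->
  X p (\prod_(k <- r | P k) f k) =
  \sum_(j <- r | P j) X p (f j) * \prod_(k <- r | P k && (k != j)) f k.
  by apply: gen; rewrite /index_enum -enumT enum_uniq.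
elim: r => [|a r IH] /= => [_|/andP[nar ur]].
  by rewrite !big_nil deriv_one.
have E0 : \prod_(k <- r | P k && (k != a)) f k = \prod_(k <- r | P k) f k.
  rewrite big_seq_cond [RHS]big_seq_cond; apply: eq_bigl => k.
  by case kr: (k \in r) => //=; case: eqP kr nar => [->->|] //=; rewrite andbT.
have E1 j : j \in r -> \prod_(k <- a :: r | P k && (k != j)) f k =
  (if P a then f a else 1) * \prod_(k <- r | P k && (k != j)) f k.
  move=> jr; rewrite big_cons.
  have -> : a != j by apply: contraNneq nar => ->.
  by rewrite andbT; case: ifP; rewrite ?mul1r.
rewrite [RHS]big_cons big_cons.
have ES : \sum_(j <- r | P j) X p (f j) * \prod_(k <- a :: r | P k && (k != j)) f k
  = (if P a then f a else 1) * X p (\prod_(k <- r | P k) f k).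
  rewrite IH // big_distrr /= big_seq_cond [RHS]big_seq_cond.
  by apply: eq_bigr => j /andP[jr _]; rewrite E1 // mulrCA.
rewrite {}ES big_cons eqxx andbF E0.
by case: ifP; rewrite ?mul1r // XM.
Qed.

Definition closed2 (w : J -> J -> B) := forall p q r,
  p != q -> q != r -> r != p -> X p (w q r) + X q (w r p) + X r (w p q) = 0.

Lemma sum_perm_mulL (c : {perm J}) (F : {perm J} -> B) :
  \sum_s F (c * s)%g = \sum_s F s.
Proof. by rewrite [RHS](reindex_inj (mulgI c)). Qed.

(* Stokes: a product of closed 2-forms one of which is exact has integral 0.
   Closedness is exterior closedness only for commuting fields; here the bracket
   terms vanish on the forms at hand. *)
Lemma top_exact (k0 : A) (beta : J -> B) (sig : A -> J -> J -> B) :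
    (forall k, k != k0 -> closed2 (sig k)) ->
    (forall p q, p != q -> sig k0 p q = X p (beta q) - X q (beta p)) ->
  mu (top sig) = 0.
Proof.
move=> cl ex.
pose P (s : {perm J}) := \prod_(k | k != k0) sig k (s (k, false)) (s (k, true)).
pose S1 := \sum_(s : {perm J}) (-1) ^+ s * (X (s (k0, false)) (beta (s (k0, true))) * P s).
pose S2 := \sum_(s : {perm J}) (-1) ^+ s * (beta (s (k0, true)) * X (s (k0, false)) (P s)).
have S12 : mu (S1 + S2) = 0.
  rewrite -big_split raddf_sum big1 // => s _ /=.
  rewrite -mulrDr -XM mulr_sign.
  by case: ifP; rewrite ?raddfN muX ?oppr0.
have topE : top sig = S1 *+ 2.
  (* Exchanging the two arguments at [k0] changes the sign of the permutation and turns the term X p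
     (beta q) into the term X q (beta p), so the two halves of the exact form contribute equally. *)
  pose t := tperm (k0, false) (k0, true) : {perm J}.
  rewrite mulr2n {2}/S1 -(sum_perm_mulL t) -big_split /=; apply: eq_bigr => s _.
  rewrite (bigD1 k0) //= -/(P s) odd_permM odd_tperm.
  rewrite (_ : P (t * s)%g = P s); last first.
    by apply: eq_bigr => k kk0; rewrite !permM !tpermD // xpair_eqE eq_sym (negbTE kk0).
  rewrite !permM tpermL tpermR /= ex ?(inj_eq perm_inj) ?xpair_eqE ?andbF //.
  by rewrite signr_addb /= expr1 mulN1r mulrBl mulrBr mulNr.
have S2E : mu S2 = 0.
  pose T j (s : {perm J}) := (-1) ^+ s * (beta (s (k0, true)) *
     (X (s (k0, false)) (sig j (s (j, false)) (s (j, true))) *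
      \prod_(k | (k != k0) && (k != j)) sig k (s (k, false)) (s (k, true)))).
  pose S j := \sum_s T j s.
  have -> : S2 = \sum_(j | j != k0) S j.
    rewrite /S exchange_big /=; apply: eq_bigr => s _.
    by rewrite deriv_prod !mulr_sumr.
  rewrite raddf_sum big1 // => j jk0 /=.
  (* The slots (k0,false), (j,false), (j,true) are rotated by the even 3-cycle [c]; the three
     rotated summands add up to the closedness relation of [sig j]. The factor 3 is cancelled after
     applying [mu], since C is a domain of characteristic 0 while B is only a ring. *)
  suff : mu (S j *+ 3) = 0.
    by rewrite raddfMn => /eqP; rewrite mulrn_eq0 /= => /eqP.
  pose u := tperm (k0, false) (j, false) : {perm J}.
  pose v := tperm (j, false) (j, true) : {perm J}.
  pose c := (u * v)%g.
  have k0j : k0 != j by rewrite eq_sym.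
  have c1 : c (k0, false) = (j, true) by rewrite permM tpermL tpermL.
  have c2 : c (j, false) = (k0, false).
    by rewrite permM tpermR tpermD // ; apply/eqP => -[] e; rewrite e eqxx in jk0.
  have c3 : c (j, true) = (j, false).
    rewrite permM (@tpermD _ (k0, false)) ?tpermR //; apply/eqP => -[] // e.
  have cD x : x \notin [:: (k0, false); (j, false); (j, true)] -> c x = x.
    rewrite !inE !negb_or => /and3P[x1 x2 x3].
    by rewrite permM !tpermD // eq_sym.
  have oc : odd_perm c = false.
    rewrite odd_permM !odd_tperm.
    by rewrite !xpair_eqE !eqxx (negbTE k0j).
  clearbody c.
  have cb s : (c * s)%g (k0, true) = s (k0, true).
    by rewrite permM cD // !inE !negb_or !xpair_eqE andbF (negbTE k0j).
  have cP s : \prod_(k | (k != k0) && (k != j)) sig k ((c * s)%g (k, false)) ((c * s)%g (k, true))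
     = \prod_(k | (k != k0) && (k != j)) sig k (s (k, false)) (s (k, true)).
    apply: eq_bigr => k /andP[kk0 kj].
    by rewrite !permM !cD // !inE !negb_or /= !xpair_eqE /= ?andbF ?andbT ?kk0 ?kj.
  rewrite (_ : S j *+ 3 = 0) ?raddf0 //.
  have -> : S j *+ 3 = S j + (\sum_s T j (c * s)%g + \sum_s T j (c * c * s)%g).
    by rewrite !sum_perm_mulL !mulrS mulr0n addr0.
  rewrite -!big_split big1 //= => s _.
  rewrite /T -!mulgA !cb !cP !odd_permM oc !addFb.
  rewrite -!mulrDr -!mulrDl !permM !(c1, c2, c3).
  have := cl j jk0 (s (k0, false)) (s (j, false)) (s (j, true)).
  rewrite !(inj_eq perm_inj) addrAC -addrA => ->;
    by rewrite ?mul0r ?mulr0 ?xpair_eqE ?andbF ?(negbTE k0j).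
rewrite topE raddfMn.
by move: S12; rewrite raddfD S2E addr0 => ->; rewrite mul0rn.
Qed.

Definition bracket p q f := X p (X q f) - X q (X p f).

Lemma bracketM p q f g : bracket p q (f * g) = bracket p q f * g + f * bracket p q g.
Proof. by rewrite /bracket !XM !raddfD /= !XM; ring. Qed.

Lemma deriv_horner p (u : {poly B}) t : (forall i, X p u`_i = 0) ->
  X p u.[t] = u^`().[t] * X p t.
Proof.
elim/poly_ind: u => [|u c IH] Hu; first by rewrite deriv0 !horner0 raddf0 mul0r.
have Hc : X p c = 0.
  by have := Hu 0%N; rewrite coefD coefMX coefC /= add0r.
have Hu' i : X p u`_i = 0.
  by have := Hu i.+1; rewrite coefD coefMX coefC /= addr0.
rewrite hornerMXaddC raddfD XM /= IH // Hc derivD derivC !addr0 derivM derivX.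
by rewrite mulr1 hornerD hornerMX; ring.
Qed.

Lemma bracket_horner p q (u : {poly B}) t : (forall i, X p u`_i = 0) ->
  (forall i, X q u`_i = 0) -> bracket p q u.[t] = u^`().[t] * bracket p q t.
Proof.
move=> Hp Hq; rewrite /bracket !deriv_horner // !XM.
have H' r : (forall i, X r u`_i = 0) -> forall i, X r (u^`())`_i = 0.
  by move=> Hr i; rewrite coef_deriv raddfMn Hr mul0rn.
by rewrite !deriv_horner //; [ring | apply: H' | apply: H'].
Qed.

(** [F k] models a section of a line bundle, lifted to the total space where the connection is
    differentiation along the fields X p; this is why the commutator of two fields acts on it as
    multiplication by the curvature, and on its conjugate [G k] by the opposite. *)
Variables (F G : A -> B) (curv : A -> J -> J -> B) (u : A -> {poly B}).
Hypothesis XC : forall p q r, p != q -> q != r -> r != p ->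
  forall f, bracket p q (X r f) = X r (bracket p q f).
Hypothesis bracketF : forall k p q, p != q -> bracket p q (F k) = curv k p q * F k.
Hypothesis bracketG : forall k p q, p != q -> bracket p q (G k) = - curv k p q * G k.
Hypothesis Xcurv : forall k p q r, X r (curv k p q) = 0.
Hypothesis Xu : forall k p i, X p (u k)`_i = 0.

(* G k stands for the conjugate of F k, and u k for an approximation of 1/t: the
   form curv k - d (beta k) is small where u k is a good approximation at F k * G k. *)
Let beta k p := (u k).[F k * G k] * G k * X p (F k).

(** With t = F G and h(t) = t u(t) this is (1 - h) curv - h'(t) dG dF, a polynomial analogue of a
    Thom form pulled back by the section [F k]. *)
Definition thom_form k p q : B :=
  curv k p q * (1 - (u k * 'X).[F k * G k]) -
  (u k * 'X)^`().[F k * G k] * (X p (G k) * X q (F k) - X q (G k) * X p (F k)).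

Lemma thom_formE k p q : p != q ->
  thom_form k p q = curv k p q - (X p (beta k q) - X q (beta k p)).
Proof.
move=> pq; have := bracketF k pq; rewrite /bracket => /eqP; rewrite subr_eq => /eqP e.
rewrite /thom_form /beta !XM e !deriv_horner // !XM derivM derivX mulr1 hornerD !hornerMX.
by ring.
Qed.

(** The weight of [G k] cancels that of X r (F k), which by [XC] is the weight of [F k]. This
    invariance is what makes d(d beta) vanish although the fields do not commute. *)
Lemma bracket_beta k p q r : p != q -> q != r -> r != p -> bracket p q (beta k r) = 0.
Proof.
move=> pq qr rp; rewrite /beta !bracketM bracket_horner // bracketM XC // bracketF // bracketG //.
by rewrite XM Xcurv; ring.
Qed.

Lemma thom_form_closed k : closed2 (thom_form k).
Proof.
move=> p q r pq qr rp; rewrite !thom_formE // !raddfB /= !Xcurv.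
have := bracket_beta k pq qr rp; have := bracket_beta k qr rp pq; have := bracket_beta k rp pq qr.
rewrite /bracket.
move=> /eqP; rewrite subr_eq0 => /eqP ->; move=> /eqP; rewrite subr_eq0 => /eqP ->.
by move=> /eqP; rewrite subr_eq0 => /eqP ->; ring.
Qed.

Lemma mu_top_thom_form : mu (top thom_form) = mu (top curv).
Proof.
(* The curvatures are exchanged one index at a time; each exchange alters the product by one with an
   exact factor and otherwise closed factors, to which [top_exact] applies. *)
pose sig (s : seq A) k := if k \in s then thom_form k else curv k.
suff H s : uniq s -> mu (top (sig s)) = mu (top curv).
  rewrite -(H (enum A)) ?enum_uniq //; congr (mu _); apply: eq_bigr => t _.
  by congr (_ * _); apply: eq_bigr => k _; rewrite /sig mem_enum inE.
elim: s => [|a s IH] /=.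
  by move=> _; congr (mu _).
move=> /andP[nas us]; rewrite -IH //.
pose d k p q := if k == a then X p (beta a q) - X q (beta a p) else sig s k p q.
have -> : top (sig (a :: s)) = top (sig s) - top d.
  rewrite -sumrB; apply: eq_bigr => t _; rewrite -mulrBr; congr (_ * _).
  have D1 w : \prod_k w k (t (k, false)) (t (k, true)) =
      w a (t (a, false)) (t (a, true)) *
      \prod_(k | k != a) w k (t (k, false)) (t (k, true)) :> B by exact: bigD1.
  rewrite (D1 (sig (a :: s))) (D1 (sig s)) (D1 d).
  rewrite /sig /d mem_head (negbTE nas) eqxx thom_formE; last first.
    by rewrite (inj_eq perm_inj) xpair_eqE andbF.
  rewrite mulrBl; congr (_ * _ - _ * _); apply: eq_bigr => k /negbTE ka.
    by rewrite inE ka.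
  by rewrite inE ka.
rewrite raddfB /= [X in _ - X](_ : _ = 0) ?subr0 //.
apply: (@top_exact a (beta a)) => [k /negbTE ka|p q _]; last by rewrite /d eqxx.
move=> p q r pq qr rp; rewrite /d ka /sig; case: ifP => _.
  exact: thom_form_closed.
by rewrite !Xcurv !addr0.
Qed.

End Stokes.

(** * Polynomial functions on products of 3-spheres *)

Section Derivations.
Variables (C : comNzRingType) (A : finType).

(* (a, b, c) is the b-th coordinate on the a-th copy of C^2, conjugated if c. *)
Definition sphere_var := (A * bool * bool)%type.
Notation N := #|{: sphere_var}|.
Notation P := (mpoly N C).
Implicit Types (f g : P) (v w : sphere_var).

Definition cvar v : P := mpolyX C (mnm1 (enum_rank v)).
Definition cder v : P -> P := mderiv (enum_rank v).

HB.instance Definition _ v := GRing.Linear.copy (cder v) (cder v).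

Lemma cderM v f g : cder v (f * g) = cder v f * g + f * cder v g.
Proof. exact: mderivM. Qed.

Lemma cder_comm v w f : cder v (cder w f) = cder w (cder v f).
Proof. exact: mderiv_comm. Qed.

Lemma cder_var v w : cder v (cvar w) = (v == w)%:R.
Proof.
rewrite /cder /cvar mderivX mnm1E (inj_eq enum_rank_inj) eq_sym.
case: eqP => [->|_]; last by rewrite scale0r.
rewrite scale1r (_ : mnm_sub _ _ = mnm0) ?mpolyX0 //.
by apply/mnmP => i; rewrite mnmBE subnn mnm0E.
Qed.

(* The lowering and raising operators of su(2) on the p.1-th sphere; their bracket is
   weight_op, the infinitesimal U(1) action. *)
Definition su2 (p : A * bool) f : P :=
  cvar (p.1, false, ~~ p.2) * cder (p.1, true, p.2) f -
  cvar (p.1, true, ~~ p.2) * cder (p.1, false, p.2) f.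

Lemma su2_is_linear p : linear (su2 p).
Proof. by move=> c f g; rewrite /su2 !linearP /= -!mul_mpolyC; ring. Qed.

HB.instance Definition _ p := GRing.isLinear.Build C P P _ (su2 p) (su2_is_linear p).

Lemma su2D p : {morph su2 p : f g / f + g}. Proof. exact: raddfD. Qed.

Lemma su2Z p c f : su2 p (c *: f) = c *: su2 p f. Proof. exact: linearZ. Qed.

Lemma su2M p f g : su2 p (f * g) = su2 p f * g + f * su2 p g.
Proof. by rewrite /su2 !cderM; ring. Qed.

Definition weight_op (a : A) f : P :=
  \sum_(b : bool) (cvar (a, b, false) * cder (a, b, false) f -
                   cvar (a, b, true) * cder (a, b, true) f).

Lemma weight_op_is_linear p : linear (weight_op p).
Proof. by move=> c f g; rewrite /weight_op !big_bool /= !linearP /= -!mul_mpolyC; ring. Qed.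

HB.instance Definition _ p :=
  GRing.isLinear.Build C P P _ (weight_op p) (weight_op_is_linear p).

Lemma weight_opM p f g : weight_op p (f * g) = weight_op p f * g + f * weight_op p g.
Proof. by rewrite /weight_op !big_bool /= !cderM; ring. Qed.

Lemma su2_comm p q f : p.1 != q.1 -> su2 p (su2 q f) = su2 q (su2 p f).
Proof.
move=> pq; have qp : q.1 != p.1 by rewrite eq_sym.
rewrite /su2 !raddfB /= !cderM !cder_var !xpair_eqE (negbTE pq) (negbTE qp) /=.
rewrite !(cder_comm (p.1, _, _) (q.1, _, _)); ring.
Qed.

Lemma su2_bracket a f :
  su2 (a, false) (su2 (a, true) f) - su2 (a, true) (su2 (a, false) f) =
  weight_op a f.
Proof.
rewrite /weight_op big_bool /su2 /= !raddfB /= !cderM !cder_var !xpair_eqE !eqxx /=.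
rewrite !(cder_comm (a, _, true) (a, _, false)); ring.
Qed.

Lemma weight_op_var a v : weight_op a (cvar v) =
  (v.1.1 == a)%:R * (-1) ^+ v.2 * cvar v.
Proof.
case: v => [[a' b] c]; rewrite /weight_op big_bool !cder_var !xpair_eqE eq_sym.
by case: eqP => [->|_]; case: b; case: c; rewrite /=; ring.
Qed.

End Derivations.

(** * Integration of polynomials over the unit interval *)

Section UnitIntegral.
Variable R : rcfType.
Implicit Types (p q : {poly R}).

(** At i = 0 the quotient is a division by 0, hence 0: this is the primitive that vanishes at 0. *)
Definition primitive p : {poly R} := \poly_(i < (size p).+1) (p`_i.-1 / i%:R).

Lemma coef_primitive p i : (primitive p)`_i = p`_i.-1 / i%:R.
Proof.
rewrite coef_poly; case: ltnP => // hi; rewrite nth_default ?mul0r //.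
by case: i hi.
Qed.

Lemma deriv_primitive p : (primitive p)^`() = p.
Proof.
apply/polyP => i; rewrite coef_deriv coef_primitive /=.
by rewrite -[LHS]mulr_natr divfK // pnatr_eq0.
Qed.

Lemma primitive_is_linear : linear primitive.
Proof.
move=> c p q; apply/polyP => i.
by rewrite coefD coefZ !coef_primitive coefD coefZ mulrDl mulrA.
Qed.

Definition integral01 p : R := (primitive p).[1].

Lemma integral01_is_scalar : scalar integral01.
Proof. by move=> c p q; rewrite /integral01 primitive_is_linear hornerD hornerZ. Qed.

HB.instance Definition _ :=
  GRing.isLinear.Build R {poly R} R _ integral01 integral01_is_scalar.

Lemma integral01B p q : integral01 (p - q) = integral01 p - integral01 q.
Proof. exact: raddfB. Qed.

Lemma integral01Z c p : integral01 (c *: p) = c * integral01 p.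
Proof. exact: linearZ. Qed.

Lemma primitive_at0 p : (primitive p).[0] = 0.
Proof. by rewrite horner_coef0 coef_primitive invr0 mulr0. Qed.

Lemma integral01_deriv p : integral01 p^`() = p.[1] - p.[0].
Proof.
suff H : primitive p^`() = p - (p.[0])%:P.
  by rewrite /integral01 H hornerD hornerN hornerC.
apply/polyP => -[|i]; rewrite coef_primitive coefB coefC.
  by rewrite invr0 mulr0 horner_coef0 subrr.
by rewrite subr0 coef_deriv /= -[X in X / _]mulr_natr mulfK // pnatr_eq0.
Qed.

Lemma integral01_mvt p : exists2 c, 0 <= c <= 1 & integral01 p = p.[c].
Proof.
have [c] := @mvt R 0 1 (primitive p) ltr01.
rewrite inE /= => /andP[c0 c1]; rewrite primitive_at0 deriv_primitive !subr0 mulr1.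
by exists c => //; rewrite !ltW.
Qed.

(** A mean value theorem in several variables, by treating them one at a time: with the others
    frozen, the sum is the integral of a single polynomial in the remaining variable. The point is
    common to all summands. *)
Lemma integral01_mvt_prod (A : finType) (I : Type) (r : seq I) (c : I -> R)
    (f : I -> A -> {poly R}) :
  exists2 x : A -> R, (forall a, 0 <= x a <= 1) &
    \sum_(i <- r) c i * \prod_a integral01 (f i a) =
    \sum_(i <- r) c i * \prod_a (f i a).[x a].
Proof.
pose ev (s : seq A) (x : A -> R) a p := if a \in s then p.[x a] else integral01 p.
suff H s : exists2 x : A -> R, (forall a, 0 <= x a <= 1) &
    \sum_(i <- r) c i * \prod_a integral01 (f i a) =
    \sum_(i <- r) c i * \prod_a ev s x a (f i a).
  have [x x01 ->] := H (enum A); exists x => //; apply: eq_bigr => i _.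
  by congr (_ * _); apply: eq_bigr => a _; rewrite /ev mem_enum inE.
elim: s => [|a s [x x01 ->]].
  by exists (fun=> 0) => // a; rewrite lexx ler01.
have [as_|nas] := boolP (a \in s).
  exists x => //; apply: eq_bigr => i _; congr (_ * _); apply: eq_bigr => b _.
  by rewrite /ev inE; case: eqP => [->|]; rewrite ?as_.
pose q := \sum_(i <- r) (c i * \prod_(b | b != a) ev s x b (f i b)) *: f i a.
have [y y01 ye] := integral01_mvt q.
exists (fun b => if b == a then y else x b) => [b|]; first by case: eqP.
have D1 t u i : \prod_b ev t u b (f i b) =
    ev t u a (f i a) * \prod_(b | b != a) ev t u b (f i b) by exact: bigD1.
transitivity (integral01 q).
  rewrite raddf_sum; apply: eq_bigr => i _ /=.
  by rewrite linearZ /= D1 {1}/ev (negbTE nas) mulrCA [RHS]mulrC.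
rewrite ye horner_sum; apply: eq_bigr => i _; rewrite hornerZ.
rewrite D1 {2}/ev mem_head eqxx -mulrA [_ * (f i a).[y]]mulrC; congr (_ * (_ * _)).
by apply: eq_bigr => b ba; rewrite /ev inE (negbTE ba).
Qed.

End UnitIntegral.

Section ComplexFacts.
Variable R : rcfType.
Local Notation C := R[i]%C.

Lemma ReD (x y : C) : complex.Re (x + y) = complex.Re x + complex.Re y.
Proof. by case: x; case: y. Qed.

Lemma Re_sum (I : Type) (r : seq I) (P : pred I) (f : I -> C) :
  complex.Re (\sum_(i <- r | P i) f i) = \sum_(i <- r | P i) complex.Re (f i).
Proof. exact: (big_morph (@complex.Re R) ReD). Qed.

Lemma ReMr (x : C) (r : R) : complex.Re (x * (r%:C)%C) = complex.Re x * r.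
Proof. by case: x => a b /=; rewrite mulr0 subr0. Qed.

Lemma conjcM (x y : C) : (x * y)^*%C = x^*%C * y^*%C.
Proof. exact: rmorphM. Qed.

Lemma conjcX (x : C) n : (x ^+ n)^*%C = x^*%C ^+ n.
Proof. exact: rmorphXn. Qed.

Lemma real_complexM (x y : R) : (x * y)%:C%C = x%:C%C * y%:C%C.
Proof. exact: rmorphM. Qed.

Lemma real_complexX (x : R) n : (x ^+ n)%:C%C = x%:C%C ^+ n.
Proof. exact: rmorphXn. Qed.

End ComplexFacts.

Lemma closed_prim_root_exists (F : closedFieldType) n : n%:R != 0 :> F ->
  {z : F | n.-primitive_root z}.
Proof.
move=> n0; have n_gt0 : (0 < n)%N by case: n n0 => //; rewrite eqxx.
pose p : {poly F} := 'X^n - 1; have [r Dp] := closed_field_poly_normal p.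
apply/sigW; rewrite (monicP _) ?monicXnsubC // scale1r in Dp.
have rn1 : all n.-unity_root r by apply/allP=> z; rewrite -root_prod_XsubC -Dp.
have sz_r : (n < (size r).+1)%N.
  by rewrite -(size_prod_XsubC r id) -Dp size_XnsubC.
have [|z] := hasP (has_prim_root n_gt0 rn1 _ sz_r); last by exists z.
by rewrite -separable_prod_XsubC -Dp separable_Xn_sub_1.
Qed.

Lemma mpoly_linear0 n (C : nzRingType) (G : mpoly n C -> C) :
    {morph G : p q / p + q} -> (forall c p, G (c *: p) = c * G p) ->
    (forall m, G (mpolyX C m) = 0) -> forall p, G p = 0.
Proof.
move=> GD GZ GX; elim/mpolyind => [|c m p _ _ IH].
  by rewrite -(scale0r 0) GZ mul0r.
by rewrite GD GZ GX IH mulr0 addr0.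
Qed.

(** * The invariant integral on a product of 3-spheres *)

Section Moment.
Variables (R : rcfType) (A : finType).
Local Notation C := R[i]%C.
Local Notation N := #|{: sphere_var A}|.
Local Notation P := (mpoly N C).
Implicit Types (m : multinom N) (p q : P).

Definition expo m (v : sphere_var A) : nat := m (enum_rank v).

Definition balanced m := [forall ab : A * bool, expo m (ab, false) == expo m (ab, true)].

(* A monomial has mean 0 on the spheres unless it is invariant under all phases, in
   which case |z_0|^2 is uniform on [0,1] on each sphere. *)
Definition beta_int (i j : nat) : R := integral01 ('X^i * (1 - 'X) ^+ j).

Definition moment m : R := (balanced m)%:R *
  \prod_a beta_int (expo m (a, false, false)) (expo m (a, true, false)).

Definition sphere_int p : C := \sum_(m <- msupp p) mcoeff m p * ((moment m)%:C)%C.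

Lemma sphere_intE k p : (msize p <= k)%N ->
  sphere_int p = \sum_(m : bmultinom N k) mcoeff m p * ((moment m)%:C)%C.
Proof.
move=> lt_pk; pose I : subFinType _ := bmultinom N k.
rewrite /sphere_int (big_mksub I) //=; first last.
- by move=> x /msize_mdeg_lt /leq_trans; apply.
- by rewrite msupp_uniq.
by rewrite big_rmcond //= => i; move/memN_msupp_eq0 ->; rewrite mul0r.
Qed.

Lemma sphere_int_is_scalar : scalar sphere_int.
Proof.
move=> c p q; pose k := maxn (msize (c *: p + q)) (maxn (msize p) (msize q)).
rewrite !(@sphere_intE k) /k ?leq_max ?leqnn ?orbT //.
rewrite mulr_sumr -big_split /=; apply: eq_bigr => m _.
by rewrite mcoeffD mcoeffZ mulrDl mulrA.
Qed.

HB.instance Definition _ :=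
  GRing.isLinear.Build C P C _ sphere_int sphere_int_is_scalar.

Lemma sphere_intX m : sphere_int (mpolyX _ m) = ((moment m)%:C)%C.
Proof. by rewrite /sphere_int msuppX big_seq1 mcoeffX eqxx mul1r. Qed.

(** Integration by parts: the boundary terms vanish because both exponents of the polynomial that is
    differentiated are positive. *)
Lemma beta_int_rec i j : j.+1%:R * beta_int i.+1 j = i.+1%:R * beta_int i j.+1.
Proof.
pose u k l : {poly R} := 'X^k * (1 - 'X) ^+ l.
have := integral01_deriv (u i.+1 j.+1).
rewrite !hornerE /= subrr expr0n mulr0 expr0n mul0r subrr.
have -> : (u i.+1 j.+1)^`() = i.+1%:R *: u i j.+1 - j.+1%:R *: u i.+1 j.
  rewrite /u derivM derivXn deriv_exp derivB derivX -(polyC1 R) derivC sub0r /=.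
  by rewrite !scaler_nat -mulr_natr -mulrnAl; ring.
rewrite integral01B !integral01Z => /eqP; rewrite subr_eq0 => /eqP E.
by rewrite /beta_int -/(u i.+1 j) -/(u i j.+1) E.
Qed.

(** In a balanced monomial a coordinate and its conjugate have equal exponents. The freedom in [c]
    lets [moment_shift] read the exponents of the kind that is being differentiated. *)
Lemma beta_intE m c : moment m = (balanced m)%:R *
  \prod_a beta_int (expo m (a, false, c)) (expo m (a, true, c)).
Proof.
rewrite /moment; case: (boolP (balanced m)) => [/forallP b|]; last by rewrite !mul0r.
congr (_ * _); apply: eq_bigr => a _; case: c => //.
by have /eqP -> := b (a, false); have /eqP -> := b (a, true).
Qed.

(** The exponent of w times the derivative in v of the monomial m. If v does not occur in m the
    subtraction truncates, but then the coefficient of the derivative is 0. *)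
Definition shift_expo m v w := mnm_add (mnm_sub m (mnm1 (enum_rank v))) (mnm1 (enum_rank w)).

Lemma expo_shift m v w u :
  expo (shift_expo m v w) u = (expo m u - (v == u) + (w == u))%N.
Proof. by rewrite /expo mnmDE mnmBE !mnm1E !(inj_eq enum_rank_inj). Qed.

(** Invariance of the integral under [su2], read on a monomial. With both exponents positive it is
    [beta_int_rec]; if exactly one is zero, the monomial on the other side is unbalanced. *)
Lemma moment_shift m a c :
  (expo m (a, true, c))%:R * moment (shift_expo m (a, true, c) (a, false, ~~ c)) =
  (expo m (a, false, c))%:R * moment (shift_expo m (a, false, c) (a, true, ~~ c)).
Proof.
have unbal b : expo m (a, b, c) = 0%N -> expo m (a, ~~ b, c) != 0%N ->
    moment (shift_expo m (a, ~~ b, c) (a, b, ~~ c)) = 0.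
  move=> b0 nb0; rewrite /moment (_ : balanced _ = false) ?mul0r //.
  apply/negbTE/negP => /forallP /(_ (a, b)); rewrite !expo_shift !xpair_eqE !eqxx /=.
  by case: c b0 nb0; case: b => /= -> _ /eqP; lia.
case: (posnP (expo m (a, true, c))) => [t0|t0].
  rewrite t0 mul0r; case: (posnP (expo m (a, false, c))) => [->|s0]; first by rewrite mul0r.
  by rewrite (unbal true) ?mulr0 // -lt0n.
case: (posnP (expo m (a, false, c))) => [s0|s0].
  by rewrite s0 mul0r (unbal false) ?mulr0 // -lt0n.
rewrite !(beta_intE _ c).
have -> : balanced (shift_expo m (a, true, c) (a, false, ~~ c)) =
          balanced (shift_expo m (a, false, c) (a, true, ~~ c)).
  apply: eq_forallb => -[a' b]; rewrite !expo_shift !xpair_eqE.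
  case: (eqVneq a a') => [<-|_] //=.
  by case: c {unbal} t0 s0; case: b => /=; lia.
rewrite mulrCA [RHS]mulrCA; congr (_ * _).
rewrite (bigD1 a) //= [in RHS](bigD1 a) //= !mulrA; congr (_ * _).
  rewrite !expo_shift !xpair_eqE !eqxx /=.
  have -> : (~~ c == c) = false by case: (c).
  case: (expo _ _) t0 => // j _; case: (expo _ _) s0 => // i _.
  by rewrite !addn0 !subn0 !subn1 /= beta_int_rec.
apply: eq_bigr => b; rewrite !expo_shift !xpair_eqE eq_sym => /negbTE -> /=.
by rewrite !subn0.
Qed.

Lemma sphere_intD p q : sphere_int (p + q) = sphere_int p + sphere_int q.
Proof. exact: raddfD. Qed.

Lemma sphere_intB p q : sphere_int (p - q) = sphere_int p - sphere_int q.
Proof. exact: raddfB. Qed.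

Lemma sphere_intZ c p : sphere_int (c *: p) = c * sphere_int p.
Proof. exact: linearZ. Qed.

Lemma sphere_int_su2X (d : A * bool) m : sphere_int (su2 d (mpolyX C m)) = 0.
Proof.
case: d => a e; rewrite /su2 /cder /cvar !mderivX -!scalerAr -!mpolyXD.
rewrite sphere_intB !sphere_intZ ![mnm_add (mnm1 _) _]addmC !sphere_intX.
have := congr1 (real_complex R) (moment_shift m a e).
rewrite !rmorphM /= !rmorph_nat => E.
by apply/eqP; rewrite subr_eq0; apply/eqP; exact: E.
Qed.

Lemma sphere_int_su2 (d : A * bool) (f : P) : sphere_int (su2 d f) = 0.
Proof.
apply: (@mpoly_linear0 _ _ (fun f => sphere_int (su2 d f))) f => [p q|c p|m].
- by rewrite su2D sphere_intD.
- by rewrite su2Z sphere_intZ.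
- exact: sphere_int_su2X.
Qed.

Lemma sphere_int1 : sphere_int 1 = 1.
Proof.
rewrite -mpolyX0 sphere_intX /moment.
have e0 v : expo (@mnm0 N) v = 0%N by rewrite /expo mnm0E.
have -> : balanced mnm0 by apply/forallP => ab; rewrite !e0.
rewrite big1 ?mulr1 // => a _; rewrite !e0 /beta_int !expr0 mulr1.
have := integral01_deriv ('X : {poly R}).
by rewrite derivX !hornerE subr0.
Qed.

Definition in_spheres (z : A * bool -> C) :=
  forall a, z (a, false) * (z (a, false))^*%C + z (a, true) * (z (a, true))^*%C = 1.

Definition coords (z : A * bool -> C) (v : sphere_var A) : C :=
  if v.2 then (z v.1)^*%C else z v.1.

Definition eval_at (z : A * bool -> C) (p : P) : C :=
  meval (fun i => coords z (enum_val i)) p.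

Lemma eval_at_var z v : eval_at z (cvar C v) = coords z v.
Proof. by rewrite /eval_at /cvar mevalXU enum_rankK. Qed.

Lemma eval_atE z p :
  eval_at z p = \sum_(m <- msupp p) mcoeff m p * \prod_(ab : A * bool)
    (z ab ^+ expo m (ab, false) * (z ab)^*%C ^+ expo m (ab, true)).
Proof.
rewrite /eval_at mevalE; apply: eq_bigr => m _; congr (_ * _).
rewrite (reindex (@enum_rank _)) /=; last exact: onW_bij (enum_rank_bij _).
rewrite (eq_bigr (fun v : sphere_var A => coords z v ^+ expo m v)) => [|v _]; last first.
  by rewrite enum_rankK.
transitivity (\prod_(ab : A * bool) \prod_(c : bool) (coords z (ab, c) ^+ expo m (ab, c))).
  by rewrite pair_bigA; apply: eq_bigr => -[].
by apply: eq_bigr => ab _; rewrite big_bool mulrC.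
Qed.

(** For exponents below n, averaging over the n-th roots of unity gives the same result as averaging
    over the whole circle. *)
Lemma sum_unity_powers n (w : C) d e : n.-primitive_root w -> (d < n)%N -> (e < n)%N ->
  \sum_(j < n) (w ^+ j) ^+ d * (w ^+ j)^*%C ^+ e = (n * (d == e))%:R.
Proof.
move=> wP dn en; have n_gt0 := prim_order_gt0 wP.
have w1 : w * w^*%C = 1.
  rewrite -sqr_normc; have : `|w| ^+ n == 1 by rewrite -normrX (prim_expr_order wP) normr1.
  by rewrite pexpr_eq1 // -?lt0n // => /eqP ->; rewrite expr1n.
pose u := w ^+ d * w^*%C ^+ e.
have -> : \sum_(j < n) (w ^+ j) ^+ d * (w ^+ j)^*%C ^+ e = \sum_(j < n) u ^+ j.
  by apply: eq_bigr => j _; rewrite rmorphXn /= exprMn -!exprM ![(_ * j)%N]mulnC.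
case: eqP => [de|/eqP de].
  rewrite muln1 (eq_bigr (fun=> 1)) ?sumr_const ?card_ord // => j _.
  by rewrite /u de -exprMn w1 !expr1n.
rewrite muln0; have un : u ^+ n = 1.
  rewrite exprMn -!exprM ![(_ * n)%N]mulnC !exprM -rmorphXn /= (prim_expr_order wP).
  by rewrite rmorph1 !expr1n mulr1.
have : (u - 1) * \sum_(j < n) u ^+ j = 0 by rewrite -subrX1 un subrr.
move/eqP; rewrite mulf_eq0 => /orP[|/eqP //].
rewrite subr_eq0 => /eqP u1; case/negP: de.
have : w ^+ d = w ^+ e.
  by rewrite -[LHS]mulr1 -(expr1n _ e) -w1 exprMn mulrCA -/u u1 mulr1.
by move/eqP; rewrite (eq_prim_root_expr wP) !modn_small.
Qed.

Lemma expo_lt_msize p m v : m \in msupp p -> (expo m v < msize p)%N.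
Proof.
move=> /msize_mdeg_lt; apply: leq_ltn_trans.
by rewrite mdegE (bigD1 (enum_rank v)) //= leq_addr.
Qed.

(** The integral is an exact finite average: the radii come from the mean value theorem, the phases
    range over roots of unity of an order exceeding the degree. Some point of the average has a real
    part at least equal to the mean. *)
Lemma sphere_int_mean p :
  exists2 z, in_spheres z & complex.Re (sphere_int p) <= complex.Re (eval_at z p).
Proof.
pose n := (msize p).+1; have [//|w wP] := @closed_prim_root_exists C n.
  by rewrite pnatr_eq0.
pose f (m : multinom N) a : {poly R} :=
  'X^(expo m (a, false, false)) * (1 - 'X) ^+ expo m (a, true, false).
pose c (m : multinom N) : R := complex.Re (mcoeff m p) * (balanced m)%:R.
have [x x01 xE] := integral01_mvt_prod (msupp p) c f.
(* The squared moduli of the coordinates; on each sphere they add up to 1. *)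
pose rho (ab : A * bool) : R := if ab.2 then 1 - x ab.1 else x ab.1.
have rho_ge0 ab : 0 <= rho ab.
  by rewrite /rho; case: ifP; rewrite ?subr_ge0; have /andP[] := x01 ab.1.
pose pt (h : {ffun A * bool -> 'I_n}) (ab : A * bool) : C :=
  (Num.sqrt (rho ab))%:C%C * w ^+ h ab.
have ww : w * w^*%C = 1.
  have n2 : (0 < n)%N by [].
  rewrite -sqr_normc; have : `|w| ^+ n == 1 by rewrite -normrX (prim_expr_order wP) normr1.
  by rewrite pexpr_eq1 // => /eqP ->; rewrite expr1n.
have pt_in h : in_spheres (pt h).
  have H ab : pt h ab * (pt h ab)^*%C = (rho ab)%:C%C.
    rewrite /pt conjcM conjc_real mulrACA -real_complexM -expr2 sqr_sqrtr //.
    by rewrite conjcX -exprMn ww expr1n mulr1.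
  by move=> a; rewrite !H -(rmorphD (real_complex R)) /rho /= addrC subrK.
have sumE : \sum_h complex.Re (eval_at (pt h) p) =
    (n ^ #|{: A * bool}|)%:R * complex.Re (sphere_int p).
  rewrite -Re_sum.
  have -> : \sum_h eval_at (pt h) p = \sum_(m <- msupp p) mcoeff m p *
      ((n ^ #|{: A * bool}|)%:R * ((balanced m)%:R * \prod_a (f m a).[x a]))%:C%C.
    under eq_bigr do rewrite eval_atE.
    rewrite exchange_big /= big_seq [RHS]big_seq; apply: eq_bigr => m mp.
    rewrite -mulr_sumr; congr (_ * _).
    pose g (ab : A * bool) (j : 'I_n) : C :=
      ((Num.sqrt (rho ab))%:C%C * w ^+ j) ^+ expo m (ab, false) *
      ((Num.sqrt (rho ab))%:C%C * w ^+ j)^*%C ^+ expo m (ab, true).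
    rewrite -(bigA_distr_bigA g) /=.
    have gE ab : \sum_j g ab j =
        (n%:R * (expo m (ab, false) == expo m (ab, true))%:R * rho ab ^+ expo m (ab, false))%:C%C.
      transitivity ((Num.sqrt (rho ab) ^+ (expo m (ab, false) + expo m (ab, true)))%:C%C *
        \sum_(j < n) (w ^+ j) ^+ expo m (ab, false) * (w ^+ j)^*%C ^+ expo m (ab, true)).
        rewrite mulr_sumr; apply: eq_bigr => j _; rewrite /g conjcM conjc_real.
        by rewrite !exprMn mulrACA exprD real_complexM !real_complexX.
      rewrite sum_unity_powers // /n ?(leqW (expo_lt_msize _ mp)) // natrM.
      case: eqP => [->|_]; last by rewrite !mulr0 mul0r.
      by rewrite !mulr1 addnn -mul2n exprM sqr_sqrtr // mulrC real_complexM rmorph_nat.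
    rewrite (eq_bigr _ (fun ab _ => gE ab)) -rmorph_prod; congr (_ %:C)%C.
    rewrite !big_split /= prodr_const -natrX -mulrA; congr (_ * (_ * _)).
      case: (boolP (balanced m)) => [/forallP b|/forallPn[ab b]].
        by rewrite big1 // => ab _; rewrite b.
      by apply/eqP; rewrite prodf_seq_eq0; apply/hasP; exists ab; rewrite ?mem_index_enum //=
        (negbTE b).
    transitivity (\prod_a \prod_(b : bool) rho (a, b) ^+ expo m (a, b, false)).
      by rewrite pair_bigA; apply: eq_bigr => -[].
    by apply: eq_bigr => a _; rewrite big_bool /= mulrC /rho /f /= !hornerE.
  rewrite /sphere_int !Re_sum mulr_sumr.
  under eq_bigr do rewrite ReMr mulrCA.
  under [RHS]eq_bigr do rewrite ReMr.
  rewrite -!mulr_sumr; congr (_ * _).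
  under eq_bigr do rewrite mulrA -/(c _).
  under [RHS]eq_bigr do rewrite mulrA -/(c _).
  by rewrite -xE.
have [/existsP[h hP]|/existsPn H] :=
    boolP [exists h, complex.Re (sphere_int p) <= complex.Re (eval_at (pt h) p)].
  by exists (pt h).
have : \sum_h complex.Re (eval_at (pt h) p) <
       \sum_(h : {ffun A * bool -> 'I_n}) complex.Re (sphere_int p).
  apply: ltr_sum; last by move=> h _; rewrite ltNge H.
  by apply/hasP; exists [ffun=> ord0]; rewrite ?mem_index_enum.
by rewrite sumr_const sumE card_ffun card_ord mulr_natl ltxx.
Qed.

End Moment.

(** * The permanent as a top-degree product *)

Section TopOfConstants.
Variable A : finType.
Let J := (A * bool)%type.

Lemma blow_up_inj (t : {perm A}) : injective (fun x : J => (t x.1, x.2)).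
Proof. by move=> [a b] [c d] /= [/perm_inj -> ->]. Qed.

Definition blow_up t : {perm J} := perm (@blow_up_inj t).

Lemma blow_upE t x : blow_up t x = (t x.1, x.2).
Proof. exact: permE. Qed.

Lemma blow_upM : {morph blow_up : s t / (s * t)%g}.
Proof. by move=> s t; apply/permP => x; rewrite permM !blow_upE permM. Qed.

Lemma blow_up1 : blow_up 1 = 1%g.
Proof. by apply/permP => -[a b]; rewrite blow_upE !perm1. Qed.

(** A transposition of A lifts to two disjoint transpositions. *)
Lemma blow_up_even t : odd_perm (blow_up t) = false.
Proof.
have [ts -> _] := prod_tpermP t.
elim: ts => [|[x y] ts IH]; first by rewrite big_nil blow_up1 odd_perm1.
rewrite big_cons blow_upM odd_permM IH addbF /=.
have [->|xy] := eqVneq x y; first by rewrite tperm1 blow_up1 odd_perm1.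
have -> : blow_up (tperm x y) =
    (tperm (x, false) (y, false) * tperm (x, true) (y, true))%g.
  apply/permP => -[a b]; rewrite permM blow_upE /=.
  have [->|xa] := eqVneq x a.
    rewrite tpermL; case: b; rewrite ?tpermL; last by rewrite tpermD // xpair_eqE andbF.
    by rewrite (@tpermD _ (a, false)) ?tpermL // xpair_eqE andbF.
  have [->|ya] := eqVneq y a.
    rewrite tpermR; case: b; rewrite ?tpermR; last by rewrite tpermD // xpair_eqE andbF.
    by rewrite (@tpermD _ (x, false)) ?tpermR // xpair_eqE andbF.
  by rewrite !tpermD // xpair_eqE ?(negbTE xa) ?(negbTE ya).
by rewrite odd_permM !odd_tperm !xpair_eqE (negbTE xy).
Qed.

Variable w : A -> A -> int.

(** The 2-form sum over a of w k a times the area form of the a-th sphere, evaluated on two vectors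
    of the frame. *)
Definition pairing k (p q : J) : int :=
  if (p.1 == q.1) && (p.2 != q.2) then (-1) ^+ p.2 * w k p.1 else 0.

Let T (s : {perm J}) : int := (-1) ^+ s * \prod_k pairing k (s (k, false)) (s (k, true)).
Let paired (s : {perm J}) :=
  [forall k, ((s (k, false)).1 == (s (k, true)).1) && ((s (k, false)).2 != (s (k, true)).2)].

Lemma pairing_antisym k p q : pairing k q p = - pairing k p q.
Proof.
case: p q => [a b] [c d]; rewrite /pairing /= eq_sym.
case: eqP => [->|_] /=; last by rewrite oppr0.
by case: b; case: d; rewrite ?oppr0 ?expr0 ?expr1 ?mul1r ?mulN1r ?opprK.
Qed.

Lemma T_unpaired s : ~~ paired s -> T s = 0.
Proof.
move=> /forallPn[k /negbTE pk]; rewrite /T (bigD1 k) //= {1}/pairing pk.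
by rewrite mul0r mulr0.
Qed.

Let flip k : {perm J} := tperm (k, false) (k, true).

Lemma flip_other k j b (s : {perm J}) : j != k -> (flip k * s)%g (j, b) = s (j, b).
Proof. by move=> jk; rewrite permM tpermD // xpair_eqE eq_sym (negbTE jk). Qed.

Lemma T_flip k s : T (flip k * s)%g = T s.
Proof.
rewrite /T odd_permM odd_tperm !xpair_eqE eqxx /=.
rewrite (bigD1 k) //= [in RHS](bigD1 k) //= !permM tpermL tpermR pairing_antisym.
rewrite signrN !mulNr mulrN opprK; congr (_ * (_ * _)).
by apply: eq_bigr => j jk; rewrite !flip_other.
Qed.

Lemma paired_flip k s : paired (flip k * s)%g = paired s.
Proof.
apply: eq_forallb => j; have [->|jk] := eqVneq j k; last by rewrite !flip_other.
by rewrite !permM tpermL tpermR eq_sym [X in ~~ X]eq_sym.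
Qed.

Let normal (r : seq A) s := paired s && all (fun k => ~~ (s (k, false)).2) r.

(** Exchanging the two slots of an index preserves the term and reverses the order of its pair, so
    prescribing that order costs a factor 2 for each index. *)
Lemma sum_T_normal r : uniq r ->
  \sum_(s | paired s) T s = (2 ^ size r)%:R * \sum_(s | normal r s) T s.
Proof.
elim: r => [|a r IH] /=.
  by rewrite mul1r => _; apply: eq_bigl => s; rewrite /normal andbT.
move=> /andP[nar ur]; rewrite IH // expnS mulnC natrM -mulrA; congr (_ * _).
rewrite mulr_natl mulr2n (bigID (fun s : {perm J} => ~~ (s (a, false)).2)) /=; congr (_ + _).
  by apply: eq_bigl => s; rewrite /normal /= andbAC andbA.
rewrite (reindex_inj (mulgI (flip a))) /=; apply: eq_big => [s|s _]; last exact: T_flip.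
rewrite negbK /normal paired_flip /= permM tpermL.
have -> : all (fun k => ~~ ((flip a * s)%g (k, false)).2) r =
          all (fun k => ~~ (s (k, false)).2) r.
  apply: eq_in_all => k kr; rewrite flip_other //.
  by apply: contraNneq nar => <-.
case: (boolP (paired s)) => //= /forallP /(_ a) /andP[_].
by case: (s (a, false)).2; case: (s (a, true)).2; case: all.
Qed.

(** A permutation with nonzero term sends each pair of slots to a pair of slots; once every pair is
    ordered, these are exactly the [blow_up] permutations. They are even, so a permanent remains and
    not a determinant. *)
Lemma sum_pairing : \sum_s T s = (2 ^ #|A|)%:R * \sum_(t : {perm A}) \prod_k w k (t k).
Proof.
rewrite (bigID paired) /= [X in _ + X]big1 ?addr0 => [|s]; last exact: T_unpaired.
rewrite (sum_T_normal (enum_uniq A)) -cardE; congr (_ * _).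
transitivity (\sum_(s in blow_up @: [set: {perm A}]) T s).
  apply: eq_bigl => s; apply/andP/imsetP => [[/forallP ps /allP ns]|[t _ ->]].
    have f2 k : (s (k, false)).2 = false by apply/negbTE/ns; rewrite mem_enum.
    have t2 k : (s (k, true)).2 = true.
      by have := ps k => /andP[_]; rewrite f2; case: (_.2).
    have inj : injective (fun k => (s (k, false)).1).
      move=> k l e; suff /perm_inj [] : s (k, false) = s (l, false) by [].
      by rewrite [LHS]surjective_pairing [RHS]surjective_pairing e !f2.
    exists (perm inj) => //; apply/permP => -[k b]; rewrite blow_upE permE /=.
    case: b; rewrite [LHS]surjective_pairing ?f2 ?t2 //.
    by have /andP[/eqP <-] := ps k.
  split; first by apply/forallP => k; rewrite !blow_upE /= eqxx.
  by apply/allP => k _; rewrite blow_upE.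
rewrite big_imset /= => [|s t _ _ e]; last first.
  by apply/permP => k; have /permP /(_ (k, false)) := e; rewrite !blow_upE /= => -[].
rewrite big_set; apply: eq_bigr => t _; rewrite /T blow_up_even mul1r.
by apply: eq_bigr => k _; rewrite /pairing !blow_upE /= eqxx mul1r.
Qed.

End TopOfConstants.

Definition normsq (R : rcfType) (x : R[i]%C) : R := complex.Re x ^+ 2 + complex.Im x ^+ 2.

(** * Existence of common zeros *)

Section Compactness.
Variables (R : realType) (A : finType).
Local Notation C := R[i]%C.
Local Notation N := #|{: sphere_var A}|.
Local Notation P := (mpoly N C).

Section Continuity.
Variable T : topologicalType.
Implicit Types f g : T -> C.

Definition cont2 f := continuous (fun v => complex.Re (f v)) /\
                      continuous (fun v => complex.Im (f v)).

Lemma cont2_cst c : cont2 (fun=> c).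
Proof. by split => v; exact: cvg_cst. Qed.

Lemma cont2D f g : cont2 f -> cont2 g -> cont2 (fun v => f v + g v).
Proof.
move=> [f1 f2] [g1 g2]; split => v.
- rewrite (_ : (fun v => _) = (fun v => complex.Re (f v)) \+ (fun v => complex.Re (g v))).
    by apply: continuousD; [exact: f1|exact: g1].
  by apply/funext => u /=; case: (f u); case: (g u).
- rewrite (_ : (fun v => _) = (fun v => complex.Im (f v)) \+ (fun v => complex.Im (g v))).
    by apply: continuousD; [exact: f2|exact: g2].
  by apply/funext => u /=; case: (f u); case: (g u).
Qed.

Lemma cont2M f g : cont2 f -> cont2 g -> cont2 (fun v => f v * g v).
Proof.
move=> [f1 f2] [g1 g2]; split => v.
- rewrite (_ : (fun v => _) = (fun v => complex.Re (f v)) \* (fun v => complex.Re (g v))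
      \- (fun v => complex.Im (f v)) \* (fun v => complex.Im (g v))).
    by apply: continuousB; apply: continuousM; [exact: f1|exact: g1|exact: f2|exact: g2].
  by apply/funext => u /=; case: (f u); case: (g u).
- rewrite (_ : (fun v => _) = (fun v => complex.Re (f v)) \* (fun v => complex.Im (g v))
      \+ (fun v => complex.Im (f v)) \* (fun v => complex.Re (g v))).
    by apply: continuousD; apply: continuousM; [exact: f1|exact: g2|exact: f2|exact: g1].
  by apply/funext => u /=; case: (f u); case: (g u).
Qed.

Lemma cont2J f : cont2 f -> cont2 (fun v => (f v)^*%C).
Proof.
move=> [f1 f2]; split => v.
- rewrite (_ : (fun v => _) = (fun v => complex.Re (f v))); first exact: f1.
  by apply/funext => u /=; case: (f u).
- rewrite (_ : (fun v => _) = \- (fun v => complex.Im (f v))).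
    by apply: continuousN; exact: f2.
  by apply/funext => u /=; case: (f u).
Qed.

Lemma cont2X f n : cont2 f -> cont2 (fun v => f v ^+ n).
Proof.
move=> cf; elim: n => [|n IH].
  rewrite (_ : (fun v => _) = fun=> 1); first exact: cont2_cst.
  by apply/funext => v; rewrite expr0.
rewrite (_ : (fun v => _) = fun v => f v * f v ^+ n); first exact: cont2M.
by apply/funext => v; rewrite exprS.
Qed.

Lemma cont2_prod (I : Type) (r : seq I) (f : I -> T -> C) :
  (forall i, cont2 (f i)) -> cont2 (fun v => \prod_(i <- r) f i v).
Proof.
move=> cf; elim: r => [|i r IH].
  rewrite (_ : (fun v => _) = fun=> 1); first exact: cont2_cst.
  by apply/funext => v; rewrite big_nil.
rewrite (_ : (fun v => _) = fun v => f i v * \prod_(i <- r) f i v); first exact: cont2M.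
by apply/funext => v; rewrite big_cons.
Qed.

Lemma cont2_sum (I : Type) (r : seq I) (f : I -> T -> C) :
  (forall i, cont2 (f i)) -> cont2 (fun v => \sum_(i <- r) f i v).
Proof.
move=> cf; elim: r => [|i r IH].
  rewrite (_ : (fun v => _) = fun=> 0); first exact: cont2_cst.
  by apply/funext => v; rewrite big_nil.
rewrite (_ : (fun v => _) = fun v => f i v + \sum_(i <- r) f i v); first exact: cont2D.
by apply/funext => v; rewrite big_cons.
Qed.

Lemma continuous_normsq f : cont2 f -> continuous (fun v => normsq (f v)).
Proof.
move=> cf; have [+ _] := cont2M cf (cont2J cf).
rewrite (_ : (fun v => normsq (f v)) = fun v => complex.Re (f v * (f v)^*%C)) //.
by apply/funext => v; rewrite /normsq; case: (f v) => a b /=; rewrite mulrN opprK -!expr2.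
Qed.

Lemma continuous_sum (I : Type) (r : seq I) (f : I -> T -> R) :
  (forall i, continuous (f i)) -> continuous (fun v => \sum_(i <- r) f i v).
Proof.
move=> cf; elim: r => [|i r IH].
  rewrite (_ : (fun v => _) = fun=> 0); first by move=> v; exact: cvg_cst.
  by apply/funext => v; rewrite big_nil.
rewrite (_ : (fun v => _) = f i \+ (fun v => \sum_(i <- r) f i v)).
  by move=> v; apply: continuousD; [exact: cf|exact: IH].
by apply/funext => v; rewrite big_cons.
Qed.

End Continuity.

Lemma eval_at_ext z z' (p : P) : z =1 z' -> eval_at z p = eval_at z' p.
Proof. by move=> e; apply: meval_eq => i; rewrite /coords !e. Qed.

Local Notation V := ('rV[R]_#|{: sphere_var A}|).

(** The last component of a [sphere_var] here distinguishes the imaginary from the real part, not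
    the conjugate from the coordinate. *)
Let point (v : V) (ab : A * bool) : C :=
  (v ord0 (enum_rank (ab, false)) +i* v ord0 (enum_rank (ab, true)))%C.

Lemma cont2_point ab : cont2 (fun v => point v ab).
Proof. by split => v; exact: coord_continuous. Qed.

Lemma cont2_eval_at (p : P) : cont2 (fun v => eval_at (point v) p).
Proof.
rewrite (_ : (fun v => _) = fun v => \sum_(m <- msupp p) mcoeff m p *
   \prod_(ab : A * bool) (point v ab ^+ expo m (ab, false) *
                          (point v ab)^*%C ^+ expo m (ab, true))); last first.
  by apply/funext => v; rewrite eval_atE.
apply: cont2_sum => m; apply: cont2M; first exact: cont2_cst.
apply: cont2_prod => ab; apply: cont2M; apply: cont2X; last apply: cont2J.
  exact: cont2_point.
exact: cont2_point.
Qed.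

Lemma in_spheresE (z : A * bool -> C) :
  in_spheres z <-> forall a, normsq (z (a, false)) + normsq (z (a, true)) = 1.
Proof.
have H x : x * x^*%C = (normsq x)%:C%C.
  by case: x => a b; rewrite /normsq /=; apply/eqP; rewrite eq_complex /=;
    apply/andP; split; apply/eqP; ring.
split=> h a; have := h a; rewrite !H -(rmorphD (real_complex R)).
  by move/complexI.
by move=> ->.
Qed.

Lemma compact_spheres : compact [set v | in_spheres (point v)]%classic.
Proof.
apply: bounded_closed_compact.
  exists 1; split; first exact: num_real.
  move=> M M1 v /= /in_spheresE vS; apply/ltW/(le_lt_trans _ M1).
  rewrite [leLHS]/Num.norm /=.
  have [->|/mx_norm_neq0[[i j] ->]] := eqVneq (mx_norm v) 0; first exact: ler01.
  move=> /=.
  rewrite ord1 -(enum_valK j); case: (enum_val j) => [[a b] c].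
  suff : v ord0 (enum_rank (a, b, c)) ^+ 2 <= 1.
    by move=> x1; rewrite ler_norml; apply/andP; split; nra.
  have := vS a; rewrite /normsq /= => <-.
  have h u : 0 <= v ord0 u ^+ 2 by exact: sqr_ge0.
  have h1 := h (enum_rank (a, false, false)); have h2 := h (enum_rank (a, false, true)).
  have h3 := h (enum_rank (a, true, false)); have h4 := h (enum_rank (a, true, true)).
  by case: b; case: c; lra.
rewrite (_ : [set v | _]%classic = \bigcap_(a in setT)
   (((fun v => normsq (point v (a, false))) \+
      (fun v => normsq (point v (a, true)))) @^-1` [set x | x = 1]))%classic.
  apply: closed_bigI => a _; apply: preimage_closed; last exact: closed_eq.
  move=> v _; apply: continuousD; apply: continuous_normsq; exact: cont2_point.
apply/seteqP; split => v /=.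
  by move=> /in_spheresE h a _; exact: h.
by move=> h; apply/in_spheresE => a; exact: (h a I).
Qed.

Lemma normsq_ge0 (x : C) : 0 <= normsq x.
Proof. by rewrite addr_ge0 ?sqr_ge0. Qed.

Lemma normsq_eq0 (x : C) : (normsq x == 0) = (x == 0).
Proof. by case: x => a b; rewrite /normsq paddr_eq0 ?sqr_ge0 // !sqrf_eq0 eq_complex. Qed.

Lemma min_on_spheres (B : finType) (F : B -> P) :
    (forall z, in_spheres z -> exists k, eval_at z (F k) != 0) ->
  exists2 c : R, 0 < c &
    forall z, in_spheres z -> exists k, c <= normsq (eval_at z (F k)).
Proof.
move=> nz; pose f v := \sum_k normsq (eval_at (point v) (F k)).
have cf : continuous f.
  by apply: continuous_sum => k; apply: continuous_normsq; exact: cont2_eval_at.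
have lift (z : A * bool -> C) : in_spheres z ->
    exists2 v, in_spheres (point v) & forall p, eval_at z p = eval_at (point v) p.
  move=> zS; pose v : V := \row_i (if (enum_val i).2 then complex.Im (z (enum_val i).1)
                                   else complex.Re (z (enum_val i).1)).
  have zv : z =1 point v.
    by move=> ab; rewrite /point !mxE !enum_rankK /=; case: (z ab).
  exists v; last by move=> p; exact: eval_at_ext.
  by move=> a; rewrite -!zv; exact: zS.
(* Used only to know that the product of spheres is nonempty. *)
have [z0 z0S _] := sphere_int_mean (0 : P).
have [v0 v0S _] := lift z0 z0S.
have [||c] := @compact_EVT_min _ R f _ _ compact_spheres.
- by exists v0.
- exact: continuous_subspaceT.
rewrite inE /= => cS cmin; have fc : 0 < f c.
  have [k kP] := nz _ cS; rewrite /f (bigD1 k) //=; apply: ltr_wpDr.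
    by apply: sumr_ge0 => j _; exact: normsq_ge0.
  by rewrite lt_def normsq_eq0 kP normsq_ge0.
(* Dividing by one more than the number of summands makes the final comparison strict. *)
exists (f c / #|B|.+1%:R); first by rewrite divr_gt0 // ltr0Sn.
move=> z /lift[v vS ev]; have [/existsP[k kP]|/existsPn H] :=
  boolP [exists k, f c / #|B|.+1%:R <= normsq (eval_at z (F k))]; first by exists k.
have : f c <= f v by apply: cmin; rewrite inE.
rewrite leNgt => /negP; case.
apply: (@le_lt_trans _ _ (\sum_(k : B) f c / #|B|.+1%:R)).
  by apply: ler_sum => k _; rewrite -ev ltW // ltNge H.
rewrite sumr_const -mulrnAl ltr_pdivrMr ?ltr0Sn // -[ltLHS]mulr_natr.
by rewrite ltr_pM2l // ltr_nat ltnS.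
Qed.

End Compactness.

Lemma bernoulli (R : realDomainType) (h : R) m : 0 <= h -> 1 + m%:R * h <= (1 + h) ^+ m.
Proof.
move=> h0; elim: m => [|m IH]; first by rewrite mul0r addr0 expr0.
rewrite exprSr; apply: (@le_trans _ _ ((1 + m%:R * h) * (1 + h))).
  rewrite -natr1 -subr_ge0.
  have -> : (1 + m%:R * h) * (1 + h) - (1 + (m%:R + 1) * h) = m%:R * h ^+ 2 by ring.
  by rewrite mulr_ge0 ?sqr_ge0.
by rewrite ler_wpM2r // addr_ge0.
Qed.

Lemma poly_exp_decay (R : realType) (b c e : R) d : 0 <= b < 1 -> 0 <= c -> 0 < e ->
  exists K, c * K.+1%:R ^+ d * b ^+ K < e.
Proof.
move=> /andP[b0 b1] c0 e0; have [->|bn0] := eqVneq b 0.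
  by exists 1%N; rewrite expr1 mulr0.
have bp : 0 < b by rewrite lt_def bn0.
pose h := b^-1 - 1; have h0 : 0 < h by rewrite subr_gt0 invf_gt1.
have bh : b^-1 = 1 + h by rewrite /h addrC subrK.
pose k := c * (2 * d.+1)%:R ^+ d * h^-1 ^+ d.+1.
have k0 : 0 <= k by rewrite !mulr_ge0 ?exprn_ge0 ?invr_ge0 ?(ltW h0).
(* With K = m (d + 1), Bernoulli bounds b^m by 1 / (h m). Of the d + 1 such factors, d compensate
   the power of K + 1, up to a constant, and the last one gives the smallness. *)
pose m := (Num.truncn (k / e)).+1.
have mP : k / e < m%:R by exact: truncnS_gt.
have mp : 0 < m%:R :> R by rewrite ltr0Sn.
have mb : b ^+ m <= h^-1 / m%:R.
  have hm : 0 < h * m%:R by rewrite mulr_gt0.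
  have h1 : 0 < (1 + h) ^+ m by rewrite exprn_gt0 // addr_gt0.
  rewrite -[b]invrK bh exprVn -invfM lef_pV2 ?posrE //.
  by apply: le_trans (bernoulli m (ltW h0)); rewrite mulrC lerDr ler01.
have bm0 : 0 <= b ^+ m by rewrite exprn_ge0.
exists (m * d.+1)%N; rewrite exprM exprSr.
apply: (@le_lt_trans _ _ (k / m%:R)); last by rewrite ltr_pdivrMr // mulrC -ltr_pdivrMr.
have Km : (m * d.+1).+1%:R <= (2 * d.+1)%:R * m%:R :> R.
  by rewrite -natrM ler_nat; lia.
rewrite /k [h^-1 ^+ d.+1]exprSr -!mulrA ler_wpM2l //.
rewrite !mulrA -[leRHS]mulrA; apply: ler_pM => //.
- by rewrite mulr_ge0 ?exprn_ge0.
rewrite -!exprMn lerXn2r ?nnegrE //.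
- by rewrite mulr_ge0.
- by rewrite mulr_ge0 ?invr_ge0 ?(ltW h0).
apply: (@le_trans _ _ ((2 * d.+1)%:R * m%:R * (h^-1 / m%:R))).
  by apply: ler_pM.
by rewrite mulrACA divff ?mulr1 // gt_eqF.
Qed.

Section EvalBound.
Variables (R : rcfType) (A : finType).
Local Notation C := R[i]%C.
Local Notation N := #|{: sphere_var A}|.
Local Notation P := (mpoly N C).

HB.instance Definition _ z := GRing.RMorphism.copy (@eval_at R A z)
  (@meval N C (fun i => coords z (enum_val i))).

Lemma eval_atM z : {morph @eval_at R A z : p q / p * q}.
Proof. exact: rmorphM. Qed.

Lemma eval_atB z : {morph @eval_at R A z : p q / p - q}.
Proof. exact: rmorphB. Qed.

Lemma eval_at1 z : eval_at z (1 : P) = 1.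
Proof. exact: rmorph1. Qed.

Lemma eval_at_horner z (u : {poly C}) (t : P) :
  eval_at z (map_poly (@mpolyC N C) u).[t] = u.[eval_at z t].
Proof.
rewrite -horner_map /= -map_poly_comp /=; congr (_.[_]).
by apply: map_poly_id => c _ /=; rewrite /eval_at mevalC.
Qed.

Lemma normc_sum (I : Type) (r : seq I) (Q : pred I) (f : I -> C) :
  Normc.normc (\sum_(i <- r | Q i) f i) <= \sum_(i <- r | Q i) Normc.normc (f i).
Proof.
elim/big_rec2: _ => [|i x y _ h]; first by rewrite Normc.normc0.
by apply: le_trans (le_normcD _ _) _; rewrite lerD2l.
Qed.

Lemma normc_prod (I : Type) (r : seq I) (Q : pred I) (f : I -> C) :
  Normc.normc (\prod_(i <- r | Q i) f i) = \prod_(i <- r | Q i) Normc.normc (f i).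
Proof. exact: (big_morph _ (@Normc.normcM R) (@Normc.normc1 R)). Qed.

End EvalBound.

Lemma commutator_commutes (V : zmodType) (x y z : {additive V -> V}) :
    (forall f, z (x f) = x (z f)) -> (forall f, z (y f) = y (z f)) ->
  forall f, x (y (z f)) - y (x (z f)) = z (x (y f) - y (x f)).
Proof. by move=> zx zy f; rewrite raddfB !(zx, zy). Qed.

Lemma ler_term_sum (R : numDomainType) (I : finType) (f : I -> R) i :
  (forall j, 0 <= f j) -> f i <= \sum_j f j.
Proof. by move=> f0; rewrite (bigD1 i) //= lerDl sumr_ge0. Qed.

(** * A nonzero permanent of weights forces a common zero *)

Section BorsukUlam.
Variables (R : realType) (A : finType).
Local Notation C := R[i]%C.
Local Notation N := #|{: sphere_var A}|.
Local Notation P := (mpoly N C).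

Lemma normc_coords z v : in_spheres z -> Normc.normc (@coords R A z v) <= 1.
Proof.
have H (x : C) : Normc.normc x = Num.sqrt (normsq x) by case: x.
have HJ (x : C) : Normc.normc x^*%C = Normc.normc x by case: x => a b /=; rewrite sqrrN.
have cE : Normc.normc (coords z v) = Normc.normc (z v.1).
  by rewrite /coords; case: v.2.
rewrite cE H -sqrtr1 => /in_spheresE zS; apply: ler_wsqrtr.
case: v {cE} => [[a b] c] /=; rewrite -(zS a).
by case: b; rewrite ?lerDl ?lerDr normsq_ge0.
Qed.

Definition coef_norm (p : P) : R := \sum_(m <- msupp p) Normc.normc (mcoeff m p).

Lemma normc_ge0 (x : C) : 0 <= Normc.normc x.
Proof. by case: x => a b; exact: sqrtr_ge0. Qed.

Lemma coef_norm_ge0 p : 0 <= coef_norm p.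
Proof. by apply: sumr_ge0 => m _; exact: normc_ge0. Qed.

Lemma eval_bounded z (p : P) : in_spheres z -> Normc.normc (eval_at z p) <= coef_norm p.
Proof.
have nX (x : C) n : Normc.normc (x ^+ n) = Normc.normc x ^+ n.
  by elim: n => [|n IH]; rewrite ?Normc.normc1 // !exprS Normc.normcM IH.
move=> zS; rewrite /eval_at mevalE; apply: le_trans (normc_sum _ _ _) _.
apply: ler_sum => m _; rewrite Normc.normcM ler_piMr ?normc_ge0 // normc_prod.
apply: prodr_ile1 => i _; rewrite nX exprn_ge0 ?normc_ge0 //= exprn_ile1 ?normc_ge0 //.
exact: normc_coords.
Qed.

Variables (F G : A -> P) (w : A -> A -> int).
Hypothesis wF : forall k a, weight_op a (F k) = (w k a)%:~R * F k.
Hypothesis wG : forall k a, weight_op a (G k) = - (w k a)%:~R * G k.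
Hypothesis GF : forall k z, eval_at z (G k) = (eval_at z (F k))^*%C.

Let X (p : A * bool) : {additive P -> P} := su2 p.
Let curv k (p q : A * bool) : P := (pairing w k p q)%:~R.

Lemma su2_int p (n : int) : su2 p n%:~R = 0 :> P.
Proof.
have := deriv_one (X := X) (su2M (A := A) (C := C)) p => h1.
by rewrite -[LHS]/(X p n%:~R) raddfMz h1 mul0rz.
Qed.

Lemma bracket_far p q (f : P) : p.1 != q.1 -> bracket X p q f = 0.
Proof. by move=> pq; rewrite /bracket /= su2_comm // subrr. Qed.

Lemma bracket_same (p q : A * bool) (f : P) : p != q -> p.1 = q.1 ->
  bracket X p q f = (-1) ^+ p.2 * weight_op p.1 f.
Proof.
case: p q => [a b] [c d] /= + ac; rewrite -{c}ac xpair_eqE eqxx /bracket /=.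
by case: b; case: d => //= _; rewrite ?expr0 ?mul1r ?mulN1r -su2_bracket ?opprB.
Qed.

(** Fields on different spheres commute, and each sphere carries only two of them: if p and q share
    a sphere, then r lives on another one. *)
Lemma bracket_commutes p q r : p != q -> q != r -> r != p ->
  forall f : P, bracket X p q (X r f) = X r (bracket X p q f).
Proof.
move=> pq qr rp f; have [e|n] := eqVneq p.1 q.1; last by rewrite !bracket_far // raddf0.
have rq1 : r.1 != q.1.
  case: p q r e pq qr rp => [a b] [c d] [x y] /= -> {a}.
  rewrite !xpair_eqE; have [_|//] := eqVneq x c; rewrite eqxx /=.
  by case: b; case: d; case: y.
have rp1 : r.1 != p.1 by rewrite e.
exact: (commutator_commutes (x := X p) (y := X q) (z := X r)
  (fun g => su2_comm g rp1) (fun g => su2_comm g rq1)).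
Qed.

Lemma bracket_F k p q : p != q -> bracket X p q (F k) = curv k p q * F k.
Proof.
move=> pq; rewrite /curv /pairing; have [e|n] /= := eqVneq p.1 q.1; last first.
  by rewrite bracket_far // mul0r.
have -> : p.2 != q.2.
  by case: p q pq e => [a b] [c d] + /= e; rewrite e xpair_eqE eqxx.
by rewrite bracket_same // wF intrM rmorphXn rmorphN1 mulrA.
Qed.

Lemma bracket_G k p q : p != q -> bracket X p q (G k) = - curv k p q * G k.
Proof.
move=> pq; rewrite /curv /pairing; have [e|n] /= := eqVneq p.1 q.1; last first.
  by rewrite bracket_far // oppr0 mul0r.
have -> : p.2 != q.2.
  by case: p q pq e => [a b] [c d] + /= e; rewrite e xpair_eqE eqxx.
by rewrite bracket_same // wG intrM rmorphXn rmorphN1 mulNr !mulrN !mulNr mulrA.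
Qed.

(* A truncation of e / (1 - (1 - e t)), which makes 1 - t u(t) = (1 - e t)^(K+1). *)
Definition cutoff (e : R) K : {poly C} :=
  e%:C%C *: \sum_(i < K.+1) (1 - e%:C%C *: 'X) ^+ i.

Lemma cutoffE e K : cutoff e K * 'X = 1 - (1 - e%:C%C *: 'X) ^+ K.+1.
Proof.
rewrite -[RHS]opprB subrX1 -mulNr opprB subKr /cutoff -!scalerAl.
by congr (_ *: _); exact: mulrC.
Qed.

Lemma sphere_int_int (n : int) : sphere_int (n%:~R : P) = n%:~R.
Proof. by rewrite raddfMz /= sphere_int1. Qed.

Let per := \sum_(s : {perm A}) \prod_k w k (s k).

Lemma sphere_int_top_curv : sphere_int (top curv) = ((2 ^ #|A|)%:R * per)%:~R.
Proof.
rewrite -sphere_int_int; congr sphere_int; rewrite /per -(sum_pairing w) /top raddf_sum /=.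
apply: eq_bigr => s _; rewrite intrM rmorph_prod /=; congr (_ * _).
by rewrite rmorphXn rmorphN1.
Qed.

Let th e K := thom_form X F G curv (fun=> map_poly (@mpolyC N C) (cutoff e K)).

Lemma sphere_int_top_th e K : sphere_int (top (th e K)) = ((2 ^ #|A|)%:R * per)%:~R.
Proof.
rewrite -sphere_int_top_curv.
apply: (@mu_top_thom_form C P (sphere_int (A := A) : {additive P -> C}) A X).
- exact: su2M.
- exact: sphere_int_su2.
- exact: bracket_commutes.
- exact: bracket_F.
- exact: bracket_G.
- by move=> k p q r; exact: su2_int.
- move=> k p i; rewrite coef_map /=.
  rewrite -[LHS]/(su2 p _) -[mpolyC _ _]mulr1 mul_mpolyC su2Z.
  by rewrite -[1]/(1%:~R) su2_int scaler0.
Qed.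

Let y k p q : P := su2 p (G k) * su2 q (F k) - su2 q (G k) * su2 p (F k).

Lemma eval_th z e K k p q (s := 1 - e * normsq (eval_at z (F k))) :
  eval_at z (th e K k p q) = eval_at z (curv k p q) * (s ^+ K.+1)%:C%C
   - (K.+1%:R * e * s ^+ K)%:C%C * eval_at z (y k p q).
Proof.
have tE : eval_at z (F k * G k) = (normsq (eval_at z (F k)))%:C%C.
  rewrite eval_atM GF /normsq; case: (eval_at z (F k)) => a b.
  by apply/eqP; rewrite eq_complex /=; apply/andP; split; apply/eqP; ring.
have mX : 'X = map_poly (@mpolyC N C) 'X by rewrite map_polyX.
rewrite /th /thom_form mX -!rmorphM /= deriv_map cutoffE.
rewrite eval_atB !eval_atM eval_atB eval_at1 !eval_at_horner tE.
rewrite -/(y k p q).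
rewrite derivB -(polyC1 C) derivC sub0r deriv_exp derivB derivC sub0r derivZ derivX.
rewrite !(hornerE, hornerMn) /=.
have -> : 1 - e%:C%C * (normsq (eval_at z (F k)))%:C%C = s%:C%C.
  by rewrite -real_complexM -(rmorph1 (real_complex R)) -rmorphB.
rewrite real_complexX !real_complexM rmorph_nat !real_complexX.
by rewrite -[X in - X * _]mulr_natr; ring.
Qed.

Lemma eval_top z (sig : A -> A * bool -> A * bool -> P) : eval_at z (top sig) =
  \sum_(s : {perm A * bool}) (-1) ^+ s *
    \prod_k eval_at z (sig k (s (k, false)) (s (k, true))).
Proof.
rewrite /top (raddf_sum (eval_at z)); apply: eq_bigr => s _ /=.
by rewrite eval_atM rmorph_prod rmorphXn rmorphN1.
Qed.

Lemma normc_sqr (x : C) : Normc.normc x ^+ 2 = normsq x.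
Proof. by case: x => a b; rewrite /normsq /= sqr_sqrtr // addr_ge0 ?sqr_ge0. Qed.

Lemma normc_real (r : R) : 0 <= r -> Normc.normc r%:C%C = r.
Proof. by move=> r0; rewrite /= expr0n addr0 sqrtr_sqr ger0_norm. Qed.

Lemma Re_le_normc (x : C) : complex.Re x <= Normc.normc x.
Proof.
case: x => a b /=; apply: le_trans (ler_norm a) _; rewrite -sqrtr_sqr.
by apply: ler_wsqrtr; rewrite lerDl sqr_ge0.
Qed.

Lemma intr_complex (n : int) : n%:~R = (n%:~R : R)%:C%C :> C.
Proof. by rewrite rmorph_int. Qed.

Let bnd := \sum_k \sum_p \sum_q (coef_norm (curv k p q) + coef_norm (y k p q)).

Lemma bnd_ge k p q : coef_norm (curv k p q) + coef_norm (y k p q) <= bnd.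
Proof.
have ge0 i j l : 0 <= coef_norm (curv i j l) + coef_norm (y i j l).
  by rewrite addr_ge0 ?coef_norm_ge0.
have ge0q i j : 0 <= \sum_q (coef_norm (curv i j q) + coef_norm (y i j q)).
  by apply: sumr_ge0 => q' _; exact: ge0.
apply: le_trans (ler_term_sum k (fun i => sumr_ge0 _ (fun j _ => ge0q i j))).
apply: le_trans (ler_term_sum p (ge0q k)).
exact: (ler_term_sum q (ge0 k p)).
Qed.

Lemma normc_eval_th z e K k p q : in_spheres z -> 0 <= e <= 1 ->
    e * normsq (eval_at z (F k)) <= 1 ->
  Normc.normc (eval_at z (th e K k p q)) <=
    bnd * K.+1%:R * (1 - e * normsq (eval_at z (F k))) ^+ K.
Proof.
move=> zS /andP[e0 e1] ef; rewrite eval_th; set s := 1 - _.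
have s0 : 0 <= s by rewrite subr_ge0.
have s1 : s <= 1 by rewrite gerBl mulr_ge0 // normsq_ge0.
apply: le_trans (le_normcD _ _) _; rewrite normcN !Normc.normcM.
rewrite !normc_real ?mulr_ge0 ?exprn_ge0 //.
have K1 : 1 <= K.+1%:R :> R by rewrite ler1n.
apply: (@le_trans _ _ ((coef_norm (curv k p q) + coef_norm (y k p q)) * K.+1%:R * s ^+ K)).
  rewrite 2!mulrDl; apply: lerD.
    rewrite -mulrA; apply: ler_pM; rewrite ?normc_ge0 ?exprn_ge0 ?eval_bounded //.
    by rewrite exprS ler_wpM2r ?exprn_ge0 // (le_trans s1).
  rewrite mulrC mulrA; apply: ler_pM; rewrite ?mulr_ge0 ?normc_ge0 ?exprn_ge0 //.
  by apply: ler_pM; rewrite ?mulr_ge0 ?normc_ge0 ?eval_bounded // ler_piMr.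
by rewrite ler_wpM2r ?exprn_ge0 // ler_wpM2r // bnd_ge.
Qed.

Lemma borsuk_ulam : per != 0 ->
  exists2 z : A * bool -> C, in_spheres z & forall k, eval_at z (F k) = 0.
Proof.
move=> per0; apply: contrapT => no.
have nz z : in_spheres z -> exists k, eval_at z (F k) != 0.
  move=> zS; apply: contrapT => H; apply: no; exists z => // k.
  by apply/eqP; apply: contrapT => /negP nk; apply: H; exists k.
have [c c0 cP] := min_on_spheres nz.
(* A common bound for all |F_k|^2 on the spheres; with e its inverse, 1 - e |F_k|^2 stays in
   [0, 1]. *)
pose bt := 1 + \sum_k coef_norm (F k) ^+ 2.
have bt1 : 1 <= bt by rewrite lerDl sumr_ge0 // => k _; exact: sqr_ge0.
have bt0 : 0 < bt by apply: lt_le_trans bt1.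
pose e := bt^-1.
have e01 : 0 <= e <= 1 by rewrite invr_ge0 ltW //= invf_le1.
have eF z k : in_spheres z -> e * normsq (eval_at z (F k)) <= 1.
  move=> zS; rewrite mulrC ler_pdivrMr // mul1r -normc_sqr.
  apply: (@le_trans _ _ (coef_norm (F k) ^+ 2)).
    by rewrite lerXn2r ?nnegrE ?normc_ge0 ?coef_norm_ge0 // eval_bounded.
  by rewrite /bt (bigD1 k) //= addrCA lerDl addr_ge0 // sumr_ge0 // => j _; exact: sqr_ge0.
pose b := 1 - e * c.
have e0 : 0 < e by rewrite invr_gt0.
have b1 : 0 <= b < 1.
  have [z zS _] := sphere_int_mean (0 : P); have [k kc] := cP z zS.
  rewrite subr_ge0 ltrBlDr ltrDl mulr_gt0 // andbT.
  by apply: le_trans (eF z k zS); rewrite ler_pM2l.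
pose n : int := (2 ^ #|A|)%:R * per.
have n0 : n != 0 by rewrite mulf_neq0 // pnatr_eq0 expn_eq0.
have nn0 : 0 < (n * n)%:~R :> R by rewrite ltr0z -expr2 exprn_even_gt0.
pose cst := Normc.normc (n%:~R : C) * (#|{perm A * bool}|%:R * bnd ^+ #|A|).
have bnd0 : 0 <= bnd.
  by rewrite !sumr_ge0 // => k _; rewrite !sumr_ge0 // => p _; rewrite !sumr_ge0 // => q _;
    rewrite addr_ge0 ?coef_norm_ge0.
have cst0 : 0 <= cst by rewrite !mulr_ge0 ?normc_ge0 ?exprn_ge0.
have [K KP] := poly_exp_decay #|A| b1 cst0 nn0.
(* The sign of n is unknown and [sphere_int_mean] controls a real part from below; the extra factor
   n turns the integral into n^2 > 0. *)
have [z zS] := sphere_int_mean ((n%:~R : C) *: top (th e K)).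
rewrite leNgt => /negP; case.
rewrite sphere_intZ sphere_int_top_th -/n -intrM (intr_complex (n * n)) /=.
apply: le_lt_trans KP; apply: le_trans (Re_le_normc _) _.
rewrite /eval_at mevalZ -/(eval_at z _) Normc.normcM /cst -!mulrA.
apply: ler_wpM2l; first exact: normc_ge0.
rewrite eval_top; apply: le_trans (normc_sum _ _ _) _.
rewrite mulrC -[leRHS]mulrC mulr_natl -[X in _ <= _ *+ X]/#|{perm A * bool}| -sumr_const.
apply: ler_sum => s _.
have -> : Normc.normc ((-1) ^+ s * \prod_k eval_at z (th e K k (s (k, false)) (s (k, true))))
  = \prod_k Normc.normc (eval_at z (th e K k (s (k, false)) (s (k, true)))).
  by rewrite Normc.normcM normc_prod; case: odd_perm; rewrite ?expr1 ?normcN Normc.normc1 mul1r.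
apply: (@le_trans _ _ (\prod_k (bnd * K.+1%:R * (1 - e * normsq (eval_at z (F k))) ^+ K))).
  apply: ler_prod => k _; rewrite normc_ge0 /=.
  by apply: normc_eval_th => //; exact: eF.
rewrite big_split /= prodr_const exprMn -mulrA.
apply: ler_wpM2l; first exact: exprn_ge0.
apply: ler_wpM2l; first exact: exprn_ge0.
(* A single section bounded away from 0 at z suffices: its factor is at most b^K and the others are
   at most 1. *)
have [k kc] := cP z zS; rewrite (bigD1 k) //=.
have s0 j : 0 <= 1 - e * normsq (eval_at z (F j)) by rewrite subr_ge0 eF.
apply: (@le_trans _ _ ((1 - e * normsq (eval_at z (F k))) ^+ K)).
  rewrite ler_piMr ?exprn_ge0 //; apply: prodr_ile1 => j _.
  rewrite exprn_ge0 //= exprn_ile1 // gerBl mulr_ge0 ?normsq_ge0 //.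
  exact: ltW.
rewrite lerXn2r ?nnegrE //; first by have /andP[] := b1.
by rewrite lerB // ler_pM2l.
Qed.

End BorsukUlam.

(** * Alternants and the inner product with chi_n *)

(** The maximum of k > 0 distinct naturals is at least k - 1. Removing it gives the bound by
    induction, and a minimal sum leaves it no room to exceed k - 1. *)
Lemma uniq_sumn_ge k (s : seq nat) : uniq s -> size s = k ->
  (\sum_(i < k) i <= sumn s)%N /\
  ((sumn s <= \sum_(i < k) i)%N -> forall x, x \in s -> (x < k)%N).
Proof.
elim: k s => [|k IH] s us ss; first by move/size0nil: ss => ->; rewrite big_ord0.
have [M Ms Mmax] : exists2 M, M \in s & forall x, x \in s -> (x <= M)%N.
  case: s us ss => // x s _ _; exists (foldr maxn x s).
    elim: s => [|y s IHs] /=; first by rewrite inE.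
    by rewrite /maxn; case: ltnP => _; rewrite !inE in IHs *; [case/orP: IHs => ->|];
      rewrite ?orbT ?eqxx ?orbT.
  elim: s => [|y s IHs] /= z; rewrite !inE; first by move/eqP ->.
  case/or3P => [/eqP ->|/eqP ->|zs]; rewrite leq_max ?leqnn //.
    by rewrite IHs ?orbT // inE eqxx.
  by rewrite IHs ?orbT // inE zs orbT.
have kM : (k <= M)%N.
  rewrite -ltnS -ss -(size_iota 0 M.+1); apply: uniq_leq_size => // x xs.
  by rewrite mem_iota add0n /= ltnS Mmax.
have sE : sumn s = (M + sumn (rem M s))%N by rewrite (perm_sumn (perm_to_rem Ms)).
have [] := IH (rem M s) (rem_uniq M us); first by rewrite size_rem // ss.
move=> ge _; rewrite big_ord_recr /= sE; split; first by rewrite addnC leq_add.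
move=> le x /Mmax xM; rewrite ltnS (leq_trans xM) //.
by rewrite -(leq_add2r (sumn (rem M s))) (leq_trans le) // addnC leq_add2l.
Qed.

Section Alternants.
Variables (S : comNzRingType) (n : nat).
Implicit Types (x : 'I_n -> S) (s t : 'S_n) (m : multinom n).

Definition vandermonde x : S := \prod_(i < n) \prod_(j < n | (i < j)%N) (x i - x j).

Lemma vandermonde_expand x :
  vandermonde x = \sum_(s : 'S_n) (-1) ^+ s * \prod_i x (s i) ^+ (n - i.+1).
Proof.
(* Reversing the variables turns the factors x_j - x_i of the determinant, i < j, into x_i - x_j. *)
pose r : 'S_n := perm (@rev_ord_inj n).
have rE i : r i = rev_ord i by rewrite permE.
have rr i : r (r i) = i by rewrite !rE rev_ordK.
transitivity (\det (Vandermonde n (\row_j x (r j)))).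
  rewrite det_Vandermonde /vandermonde (reindex_inj (@perm_inj _ r)) /=.
  rewrite !pair_big_dep /=.
  rewrite (reindex_onto (fun p : 'I_n * 'I_n => (p.2, r p.1)) (fun p => (r p.2, p.1))) /=; last first.
    by move=> [i j] _; rewrite rr.
  apply: eq_big => [[i j]|[i j] _] /=; last by rewrite !mxE.
  rewrite rr eqxx andbT !rE /=.
  by have := ltn_ord i; have := ltn_ord j; lia.
rewrite /determinant [RHS](reindex_inj (mulgI r)) [RHS](reindex_inj (mulIg r)) /=.
apply: eq_bigr => s _; rewrite !odd_permM addbC -addbA addbb addbF; congr (_ * _).
rewrite [RHS](reindex_inj (@perm_inj _ r)) /=; apply: eq_bigr => i _.
rewrite !permM rr !mxE !rE /=; congr (_ ^+ _); have := ltn_ord i; lia.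
Qed.

(* The exponent of the term of sign (-1)^s in the Vandermonde product. *)
Definition stair s : multinom n := Multinom [tuple (n - (s^-1%g j).+1)%N | j < n].

Lemma stairE s j : stair s j = (n - (s^-1%g j).+1)%N.
Proof. by rewrite /stair multinomE tnth_mktuple. Qed.

Lemma stair_perm s i : stair s (s i) = (n - i.+1)%N.
Proof. by rewrite stairE permK. Qed.

Lemma stair_inj : injective stair.
Proof.
move=> s t st; apply: invg_inj; apply/permP => j; apply/val_inj => /=.
have := congr1 (fun m : multinom n => m j) st; rewrite !stairE.
by move: (s^-1%g j) (t^-1%g j) => a b; have := ltn_ord a; have := ltn_ord b; lia.
Qed.

Lemma stair_val_inj s : injective (stair s).
Proof.
move=> i j; rewrite !stairE => e; apply: (@perm_inj _ s^-1%g); apply/val_inj => /=.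
move: (s^-1%g i) (s^-1%g j) e => a b.
by have := ltn_ord a; have := ltn_ord b; lia.
Qed.

Lemma injective_stair m : injective m -> mdeg m = (\sum_(i < n) i)%N ->
  exists s, m = stair s.
Proof.
move=> mi md; have [|_] := @uniq_sumn_ge n (codom m) _ (etrans (size_codom _) (card_ord n)).
  by rewrite map_inj_uniq // enum_uniq.
have sE : sumn (codom m) = mdeg m.
  by rewrite mdegE sumnE /codom /image_mem big_map big_enum.
rewrite sE md => /(_ (leqnn _)) lt.
have lt' j : (n - (m j).+1 < n)%N.
  by have := lt (m j) (codom_f _ _); lia.
have inj : injective (fun j => Ordinal (lt' j)).
  move=> i j /(congr1 val) /= e; apply: mi.
  by have := lt (m j) (codom_f _ _); have := lt (m i) (codom_f _ _); lia.
exists (perm inj)^-1%g; apply/mnmP => j; rewrite stairE invgK permE /=.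
by have := lt (m j) (codom_f _ _); lia.
Qed.

Definition alternant (p : mpoly n S) x : S :=
  \sum_(s : 'S_n) (-1) ^+ s * meval (fun i => x (s i)) p.

(** The inner product of p with chi_n, whose expansion has the coefficient (-1)^s at [stair s]. *)
Definition stair_coef (p : mpoly n S) : S := \sum_(s : 'S_n) (-1) ^+ s * mcoeff (stair s) p.

Lemma alternant_stair t x : alternant (mpolyX S (stair t)) x = (-1) ^+ t * vandermonde x.
Proof.
rewrite /alternant vandermonde_expand mulr_sumr [RHS](reindex_inj (mulgI t)) /=.
apply: eq_bigr => s _; rewrite odd_permM signr_addb !mulrA -expr2 sqrr_sign mul1r.
congr (_ * _); rewrite mevalX [LHS](reindex_inj (@perm_inj _ t)) /=.
by apply: eq_bigr => i _; rewrite permM stair_perm.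
Qed.

Lemma alternant_repeated m x : ~ injective m -> alternant (mpolyX S m) x = 0.
Proof.
move=> ni; have [i [j [ij e]]] : exists i j, i != j /\ m i = m j.
  apply: contrapT => H; apply: ni => i j e; apply/eqP/negP => /negP ij.
  by apply: H; exists i, j.
rewrite -(@determinant_alternate _ n (\matrix_(i, j) x j ^+ m i) i j ij) => [|k].
  by apply: eq_bigr => s _; rewrite mevalX; congr (_ * _); apply: eq_bigr => k _; rewrite mxE.
by rewrite !mxE e.
Qed.

(* In this degree only the exponents stair s have distinct entries, and the
   monomials with a repeated exponent have alternant 0. *)
Lemma alternant_hom p x : (forall m, m \in msupp p -> mdeg m = \sum_(i < n) i)%N ->
  alternant p x = stair_coef p * vandermonde x.
Proof.
move=> hp; rewrite /alternant {1}[p]mpolyE.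
under eq_bigr do rewrite raddf_sum mulr_sumr.
rewrite exchange_big /=.
transitivity (\sum_(m <- msupp p) \sum_(s : 'S_n)
   (-1) ^+ s * (mcoeff m p * (m == stair s)%:R) * vandermonde x).
  rewrite big_seq [RHS]big_seq; apply: eq_bigr => m /hp md.
  under eq_bigr do rewrite mevalZ mulrCA.
  rewrite -mulr_sumr -/(alternant _ x).
  have [mi|ni] := pselect (injective m).
    have [t mt] := injective_stair mi md; rewrite mt alternant_stair.
    rewrite (bigD1 t) //= big1 ?addr0 => [|s st]; last first.
      by rewrite (inj_eq stair_inj) eq_sym (negbTE st) !mulr0 mul0r.
    by rewrite eqxx mulr1 mulrA [mcoeff _ _ * _]mulrC.
  rewrite alternant_repeated // mulr0 big1 // => s _.
  case: eqP => [ms|_]; last by rewrite !mulr0 mul0r.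
  by case: ni; rewrite ms; exact: stair_val_inj.
rewrite exchange_big /= /stair_coef mulr_suml; apply: eq_bigr => s _.
rewrite -mulr_suml -mulr_sumr; congr (_ * _ * _).
have [sp|sp] := boolP (stair s \in msupp p).
  rewrite (bigD1_seq (stair s)) ?msupp_uniq //= eqxx mulr1 big1 ?addr0 // => m /negbTE ->.
  by rewrite mulr0.
rewrite memN_msupp_eq0 // big_seq big1 // => m mp; case: eqP => [e|_]; last by rewrite mulr0.
by rewrite e (negbTE sp) in mp.
Qed.

End Alternants.

Section PairPolynomials.
Variables (S : comNzRingType) (n : nat).
Implicit Types (ps : seq ('I_n * 'I_n)) (s : 'S_n).

Definition mvar (i : 'I_n) : mpoly n S := mpolyX S (mnm1 i).

Definition pair_poly ps : mpoly n S := \prod_(p <- ps) (mvar p.1 - mvar p.2).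

Lemma pair_poly_hom ps m : m \in msupp (pair_poly ps) -> mdeg m = size ps.
Proof.
elim: ps m => [|p ps IH] m; rewrite /pair_poly.
  by rewrite big_nil msupp1 inE => /eqP ->; rewrite mdeg0.
rewrite big_cons => /msuppM_le /allpairsP[[m1 m2] /= [m1p m2p ->]].
rewrite mdegD (IH m2) // -[RHS]add1n; congr (_ + _)%N.
by have := msuppB_le m1p; rewrite mem_cat !msuppX !inE => /orP[]/eqP ->; rewrite mdeg1.
Qed.

Lemma meval_pair_poly (x : 'I_n -> S) ps :
  meval x (pair_poly ps) = \prod_(p <- ps) (x p.1 - x p.2).
Proof.
rewrite rmorph_prod; apply: eq_bigr => p _ /=.
by rewrite mevalB !mevalXU.
Qed.

Lemma vandermonde_mvar :
  vandermonde mvar = \sum_(s : 'S_n) (-1) ^+ s *: mpolyX S (stair s).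
Proof.
rewrite vandermonde_expand; apply: eq_bigr => s _.
rewrite -mul_mpolyC rmorphXn rmorphN1; congr (_ * _).
rewrite (mpolyXE S s).
by apply: eq_bigr => i _; rewrite stair_perm.
Qed.

Definition top_expo : multinom n := Multinom [tuple n.-1 | _ < n].

(** The complement of a staircase exponent in (n-1, ..., n-1) is the reversed staircase; hence this
    coefficient of p chi_n is the inner product up to the sign of the reversal. *)
Lemma mcoeff_top_vandermonde (p : mpoly n S) :
  mcoeff top_expo (p * vandermonde mvar) = (-1) ^+ (perm (@rev_ord_inj n)) * stair_coef p.
Proof.
pose r : 'S_n := perm (@rev_ord_inj n).
have rE i : r i = rev_ord i by rewrite permE.
have r2 : (r * r = 1)%g by apply/permP => i; rewrite permM !rE rev_ordK perm1.
rewrite vandermonde_mvar mulr_sumr raddf_sum /= /stair_coef mulr_sumr.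
rewrite (reindex_inj (mulgI r)) /=; apply: eq_bigr => s _.
rewrite -scalerAr mcoeffZ odd_permM signr_addb -mulrA; congr (_ * (_ * _)).
have -> : top_expo = mnm_add (stair (r * s)%g) (stair s).
  apply/mnmP => j; rewrite mnmDE !stairE /top_expo multinomE tnth_mktuple.
  rewrite invMg permM; have -> : (r^-1 = r)%g by apply/eqP; rewrite eq_invg_mul r2.
  by rewrite rE /=; move: (s^-1%g j) => a; have := ltn_ord a; lia.
exact: mcoeffMX.
Qed.

Definition lt_pairs : seq ('I_n * 'I_n) :=
  [seq p : 'I_n * 'I_n <- enum {: 'I_n * 'I_n} | (p.1 < p.2)%N].

Lemma pair_poly_lt : pair_poly lt_pairs = vandermonde mvar.
Proof.
rewrite /pair_poly /lt_pairs big_filter big_enum_cond /vandermonde.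
by rewrite pair_big_dep.
Qed.

Lemma mcoeff_top_pair ps : mcoeff top_expo (pair_poly (ps ++ lt_pairs)) =
  (-1) ^+ (perm (@rev_ord_inj n)) * stair_coef (pair_poly ps).
Proof. by rewrite -mcoeff_top_vandermonde -pair_poly_lt /pair_poly big_cat. Qed.

End PairPolynomials.

Lemma stair_coef_int (S : comNzRingType) n (ps : seq ('I_n * 'I_n)) :
  stair_coef (pair_poly S ps) = (stair_coef (pair_poly int ps))%:~R.
Proof.
have -> : pair_poly S ps = map_mpoly intr (pair_poly int ps).
  rewrite /pair_poly rmorph_prod; apply: eq_bigr => p _.
  by rewrite rmorphB /= !map_mpolyX.
rewrite /stair_coef raddf_sum; apply: eq_bigr => s _ /=.
by rewrite mcoeff_map_mpoly intrM rmorphXn rmorphN1.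
Qed.

(** * Transfer to polynomials in infinitely many variables *)

Section RealPolynomials.
Variables (R : realType) (n : nat).
Local Notation malgR := (monalg.malg (monalg.cmonom nat) R).

Lemma malgU_mul (k l : monalg.cmonom nat) :
  monalg.mkmalgU k 1 * monalg.mkmalgU l 1 = monalg.mkmalgU (monalg.mulcm k l) 1 :> malgR.
Proof. by rewrite monalg.malgM_def monalg.fgmulUU mul1r. Qed.

Definition cmon (m : multinom n) : monalg.cmonom nat :=
  \big[@monalg.mulcm nat/@monalg.onecm nat]_(i < n)
    iter (m i) (monalg.mulcm (monalg.ucm i.+1)) (@monalg.onecm nat).

Lemma cmonE m (j : 'I_n) : cmon m j.+1 = m j.
Proof.
rewrite /cmon (big_morph (fun c : monalg.cmonom nat => c j.+1)
  (fun a b => monalg.mulcmE a b j.+1) (monalg.onecmE j.+1)).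
have itE (i : 'I_n) k : iter k (monalg.mulcm (monalg.ucm i.+1)) (@monalg.onecm nat) j.+1
    = (k * (i == j))%N.
  elim: k => [|k IH]; first by rewrite monalg.onecmE.
  by rewrite iterS monalg.mulcmE IH monalg.ucmE mulSn.
rewrite (bigD1 j) //= itE eqxx muln1 big1 ?addn0 // => i /negbTE ij.
by rewrite itE ij muln0.
Qed.

Lemma cmon_inj : injective cmon.
Proof. by move=> m m' e; apply/mnmP => j; rewrite -!cmonE e. Qed.

Definition to_malg : mpoly n R -> malgR :=
  mmap (GRing.in_alg malgR) (fun i : 'I_n => var R i.+1).

HB.instance Definition _ := GRing.RMorphism.copy to_malg
  (mmap (GRing.in_alg malgR) (fun i : 'I_n => var R i.+1)).

Lemma to_malgX m : to_malg (mpolyX R m) = monalg.mkmalgU (cmon m) 1.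
Proof.
rewrite /to_malg mmapX /mmap1 /cmon.
rewrite (big_morph (fun c => monalg.mkmalgU c 1 : malgR) (fun a b => esym (malgU_mul a b)) erefl).
apply: eq_bigr => i _; elim: (m i) => [|k IH]; first exact: expr0.
rewrite exprS IH iterS; exact: malgU_mul.
Qed.

Lemma to_malgD p q : to_malg (p + q) = to_malg p + to_malg q.
Proof. exact: mmapD. Qed.

Lemma to_malg0 : to_malg 0 = 0.
Proof. exact: mmap0. Qed.

Lemma to_malgZ c p : to_malg (c *: p) = c *: to_malg p.
Proof. by rewrite /to_malg mmapZ /= mulr_algl. Qed.

Lemma mcoeff_to_malg p m : monalg.mcoeff (cmon m) (to_malg p) = mcoeff m p.
Proof.
apply/eqP; rewrite -subr_eq0; apply/eqP.
apply: (@mpoly_linear0 _ _ (fun p => monalg.mcoeff (cmon m) (to_malg p) - mcoeff m p))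
  => [p' q|c p'|k] /=.
- by rewrite to_malgD monalg.mcoeffD mcoeffD opprD addrACA.
- by rewrite to_malgZ monalg.mcoeffZ mcoeffZ mulrBr.
- by rewrite to_malgX monalg.mcoeffU1 mcoeffX (inj_eq cmon_inj) subrr.
Qed.

Lemma to_malg_vandermonde : to_malg (vandermonde (@mvar R n)) = chi R n.
Proof.
rewrite /chi big_add1 big_mkord /vandermonde rmorph_prod; apply: eq_bigr => i _.
rewrite big_add1 /= big_geq_mkord rmorph_prod; apply: eq_bigr => j _.
by rewrite rmorphB /= /to_malg !mmapX !mmap1U.
Qed.

Lemma inner_sumU (I : finType) (c : I -> R) (k : I -> monalg.cmonom nat) (P : malgR) :
  inner P (\sum_i c i *: monalg.mkmalgU (k i) 1) = \sum_i c i * monalg.mcoeff (k i) P.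
Proof.
transitivity (\sum_i \sum_(m <- monalg.msupp P)
   c i * (monalg.mcoeff m P * (k i == m)%:R)).
  rewrite exchange_big /=; apply: eq_bigr => m _.
  rewrite (big_morph (monalg.mcoeff m) (monalg.mcoeffD m) (monalg.mcoeff0 m)) mulr_sumr.
  by apply: eq_bigr => i _; rewrite monalg.mcoeffZ monalg.mcoeffU1 mulrCA.
apply: eq_bigr => i _; rewrite -mulr_sumr; congr (_ * _).
have [kp|kp] := boolP (k i \in monalg.msupp P).
  rewrite (bigD1_seq (k i)) ?fset_uniq //= eqxx mulr1 big1 ?addr0 // => m /negbTE mk.
  by rewrite eq_sym mk mulr0.
rewrite monalg.mcoeff_outdom // big_seq big1 // => m mp; case: eqP => [e|_]; last by rewrite mulr0.
by rewrite e mp in kp.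
Qed.

Lemma inner_stair_coef (p : mpoly n R) :
  inner (to_malg p) (chi R n) = stair_coef p.
Proof.
rewrite -to_malg_vandermonde vandermonde_mvar (big_morph _ to_malgD to_malg0).
under eq_bigr do rewrite to_malgZ to_malgX.
by rewrite inner_sumU; apply: eq_bigr => s _; rewrite mcoeff_to_malg.
Qed.

Lemma inner_pair_poly (I : {fset nat * nat}) (ps : seq ('I_n * 'I_n)) :
    perm_eq [seq (p.1.+1, p.2.+1) | p : 'I_n * 'I_n <- ps] I ->
  inner (chi_pattern R I) (chi R n) = (stair_coef (pair_poly int ps))%:~R.
Proof.
move=> pI; rewrite -stair_coef_int -inner_stair_coef; congr inner.
rewrite /chi_pattern -(perm_big _ pI) big_map rmorph_prod; apply: eq_bigr => p _.
by rewrite rmorphB /= /to_malg !mmapX !mmap1U.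
Qed.

End RealPolynomials.

(** * The pattern and its recursion by steps of 4 *)

(* Membership of (i+1, j+1) in Lambda n. *)
Definition lam n (i j : nat) : bool :=
  [&& i != j, (i + j + 2 <= n + 1)%N & (i.+1, j.+1) \notin Lambda_exceptions n].

Definition exception n (i j : nat) : bool :=
  [|| [&& (i + j + 2 == n)%N, ~~ odd i & (i < 2 * (n %/ 4))%N],
      [&& (i + j + 2 == n)%N, ~~ odd j & (j < 2 * (n %/ 4))%N] |
      [&& (n %% 4 == 2)%N || (n %% 4 == 3)%N, i == (2 * (n %/ 4) + 1)%N & j == (2 * (n %/ 4))%N]].

Lemma mem_exceptions n i j : ((i.+1, j.+1) \in Lambda_exceptions n) = exception n i j.
Proof.
have n4 : (4 * (n %/ 4) <= n)%N by rewrite mulnC leq_divM.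
rewrite /Lambda_exceptions /exception !mem_cat; congr [|| _, _ | _].
- apply/mapP/and3P => [[k]|[/eqP h oi li]].
    rewrite mem_iota => kk [e1 e2]; split; lia.
  by exists (i./2).+1; [rewrite mem_iota; lia|congr pair; lia].
- apply/mapP/and3P => [[k]|[/eqP h oi li]].
    rewrite mem_iota => kk [e1 e2]; split; lia.
  by exists (j./2).+1; [rewrite mem_iota; lia|congr pair; lia].
by case: ifP => _ //=; rewrite inE xpair_eqE; congr andb; lia.
Qed.

(** Along the antidiagonal the exceptions recur at every second index, so a shift by 2 of both
    indices matches an increase of n by 4. *)
Lemma lam_shift n i j : (i < n)%N -> (j < n)%N -> lam n.+4 i.+2 j.+2 = lam n i j.
Proof.
move=> ni nj; rewrite /lam !mem_exceptions /exception.
have -> : (n.+4 %/ 4 = (n %/ 4).+1)%N by lia.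
have -> : (n.+4 %% 4 = n %% 4)%N by lia.
lia.
Qed.

Lemma lam_row0 n j : (j < n.+4)%N -> lam n.+4 0 j = (j != 0%N) && (j != n.+2).
Proof.
move=> nj; rewrite /lam !mem_exceptions /exception.
have -> : (n.+4 %/ 4 = (n %/ 4).+1)%N by lia.
lia.
Qed.

Lemma lam_col0 n j : (j < n.+4)%N -> lam n.+4 j 0 = (j != 0%N) && (j != n.+2).
Proof.
move=> nj; rewrite /lam !mem_exceptions /exception.
have -> : (n.+4 %/ 4 = (n %/ 4).+1)%N by lia.
lia.
Qed.

Lemma lam_row1 n j : (j < n.+4)%N -> lam n.+4 1 j = (j != 1%N) && (j != n.+3).
Proof.
move=> nj; rewrite /lam !mem_exceptions /exception.
have -> : (n.+4 %/ 4 = (n %/ 4).+1)%N by lia.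
have n4 : (4 * (n %/ 4) <= n)%N by rewrite mulnC leq_divM.
lia.
Qed.

Lemma lam_col1 n j : (j < n.+4)%N -> lam n.+4 j 1 = (j != 1%N) && (j != n.+3).
Proof.
move=> nj; rewrite /lam !mem_exceptions /exception.
have -> : (n.+4 %/ 4 = (n %/ 4).+1)%N by lia.
have n4 : (4 * (n %/ 4) <= n)%N by rewrite mulnC leq_divM.
lia.
Qed.

Lemma lam_last n i j : (n.+2 <= i)%N -> (2 <= j)%N -> lam n.+4 i j = false.
Proof. by move=> ni nj; rewrite /lam; case: eqP => //= _; rewrite (_ : (_ <= _)%N = false); lia. Qed.

Lemma lam_last_col n i j : (n.+2 <= j)%N -> (2 <= i)%N -> lam n.+4 i j = false.
Proof. by move=> ni nj; rewrite /lam; case: eqP => //= _; rewrite (_ : (_ <= _)%N = false); lia. Qed.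

Section LambdaProducts.
Variable F : comNzRingType.
Implicit Type y : nat -> F.

Definition lam_prod n y : F :=
  \prod_(0 <= i < n) \prod_(0 <= j < n | lam n i j) (y i - y j).

Definition vdm n y : F :=
  \prod_(0 <= i < n) \prod_(0 <= j < n | (i < j)%N) (y i - y j).

Lemma big_nat_split4 n (g : nat -> F) : \prod_(0 <= i < n.+4) g i =
  g 0%N * g 1%N * g n.+2 * g n.+3 * \prod_(0 <= i < n) g i.+2.
Proof.
rewrite big_nat_recl // big_nat_recl // big_nat_recr // big_nat_recr //=.
by rewrite !mulrA; ring.
Qed.

Lemma big_nat_split4_cond n (Q : pred nat) (g : nat -> F) :
  \prod_(0 <= i < n.+4 | Q i) g i =
  (if Q 0%N then g 0%N else 1) * (if Q 1%N then g 1%N else 1) *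
  (if Q n.+2 then g n.+2 else 1) * (if Q n.+3 then g n.+3 else 1) *
  \prod_(0 <= i < n | Q i.+2) g i.+2.
Proof. by rewrite big_mkcond big_nat_split4 [in RHS]big_mkcond. Qed.

Lemma prod_nat_false n (Q : pred nat) (g : nat -> F) :
  (forall i, (i < n)%N -> Q i = false) -> \prod_(0 <= i < n | Q i) g i = 1.
Proof. by move=> h; rewrite big_nat_cond big1 // => i /andP[/andP[_ ni]]; rewrite h. Qed.

Lemma prod_nat_true n (Q : pred nat) (g : nat -> F) :
  (forall i, (i < n)%N -> Q i) -> \prod_(0 <= i < n | Q i) g i = \prod_(0 <= i < n) g i.
Proof.
move=> h; rewrite big_nat_cond [RHS]big_nat_cond; apply: eq_bigl => i.
by case: (ltnP i n) => ni; rewrite ?andbF // h.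
Qed.

(** Outside the middle block the pattern is symmetric: each of the 2n + 3 pairs involved occurs in
    both orders and contributes minus a square. Their number is odd, hence the sign. *)
Lemma lam_prod_rec n y (a := y 0%N) (b := y 1%N) (c := y n.+2) (d := y n.+3) :
  lam_prod n.+4 y = - ((a - b) * (a - d) * (b - c) *
    \prod_(0 <= k < n) ((a - y k.+2) * (b - y k.+2))) ^+ 2 *
    lam_prod n (fun k => y k.+2).
Proof.
rewrite /lam_prod big_nat_split4 !big_nat_split4_cond.
rewrite !lam_row0 ?lam_row1 ?lam_col0 ?lam_col1; try lia.
rewrite !lam_last ?lam_last_col; try lia.
have -> : (n.+3 == n.+2) = false by lia.
have -> : (n.+2 == n.+3) = false by lia.
rewrite !eqxx /=.
rewrite !(@prod_nat_true n (fun i => lam n.+4 0 i.+2)) => [|i ni]; last by rewrite lam_row0; lia.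
rewrite !(@prod_nat_true n (fun i => lam n.+4 1 i.+2)) => [|i ni]; last by rewrite lam_row1; lia.
rewrite !(@prod_nat_false n (fun i => lam n.+4 n.+2 i.+2)) => [|i ni]; last by rewrite lam_last; lia.
rewrite !(@prod_nat_false n (fun i => lam n.+4 n.+3 i.+2)) => [|i ni]; last by rewrite lam_last; lia.
have -> : \prod_(0 <= i < n) \prod_(0 <= j < n.+4 | lam n.+4 i.+2 j) (y i.+2 - y j) =
  \prod_(0 <= i < n) ((y i.+2 - a) * (y i.+2 - b)) *
  \prod_(0 <= i < n) \prod_(0 <= j < n | lam n i j) (y i.+2 - y j.+2).
  rewrite -big_split /=; apply: eq_big_nat => i /andP[_ ni].
  rewrite big_nat_split4_cond lam_col0 ?lam_col1 ?lam_last_col; try lia.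
  have -> : ((i.+2 != 0%N) && (i.+2 != n.+2)) by lia.
  have -> : ((i.+2 != 1%N) && (i.+2 != n.+3)) by lia.
  rewrite !mulr1; congr (_ * _).
  rewrite big_nat_cond [RHS]big_nat_cond; apply: eq_bigl => j.
  by case: (ltnP j n) => nj //=; rewrite lam_shift.
rewrite -/a -/b -/c -/d !big_split /=.
have e u : \prod_(0 <= i < n) (y i.+2 - u) = (-1) ^+ n * \prod_(0 <= i < n) (u - y i.+2).
  rewrite -{2}(subn0 n) -prodr_const_nat -big_split /=.
  by apply: eq_bigr => i _; rewrite mulN1r opprB.
rewrite !e; have := sqrr_sign F n; rewrite -signr_odd.
move: (\prod_(0 <= i < n) (a - y i.+2)) (\prod_(0 <= i < n) (b - y i.+2)) => A1 B1.
case: (odd n); rewrite ?expr0 ?expr1 => _; ring.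
Qed.

Lemma vdm_rec n y (a := y 0%N) (b := y 1%N) (c := y n.+2) (d := y n.+3) :
  vdm n.+4 y = (a - b) * (a - c) * (a - d) * (b - c) * (b - d) * (c - d) *
    \prod_(0 <= k < n) ((a - y k.+2) * (b - y k.+2) * ((c - y k.+2) * (d - y k.+2))) *
    vdm n (fun k => y k.+2).
Proof.
rewrite /vdm big_nat_split4 !big_nat_split4_cond /=.
have -> : (n.+2 < n.+2)%N = false by lia.
have -> : (n.+3 < n.+2)%N = false by lia.
have -> : (n.+3 < n.+3)%N = false by lia.
have -> : (n.+2 < n.+3)%N by lia.
rewrite (@prod_nat_false n (fun i => n.+2 < i.+2)%N) => [|i ni]; last by lia.
rewrite (@prod_nat_false n (fun i => n.+3 < i.+2)%N) => [|i ni]; last by lia.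
have -> : \prod_(0 <= i < n) \prod_(0 <= j < n.+4 | (i.+2 < j)%N) (y i.+2 - y j) =
  \prod_(0 <= i < n) ((y i.+2 - c) * (y i.+2 - d)) *
  \prod_(0 <= i < n) \prod_(0 <= j < n | (i < j)%N) (y i.+2 - y j.+2).
  rewrite -big_split /=; apply: eq_big_nat => i /andP[_ ni].
  rewrite big_nat_split4_cond /=.
  have -> : (i.+2 < n.+2)%N by lia.
  have -> : (i.+2 < n.+3)%N by lia.
  by rewrite !mul1r.
rewrite -/a -/b -/c -/d !big_split /=.
have e u : \prod_(0 <= i < n) (y i.+2 - u) = (-1) ^+ n * \prod_(0 <= i < n) (u - y i.+2).
  rewrite -{2}(subn0 n) -prodr_const_nat -big_split /=.
  by apply: eq_bigr => i _; rewrite mulN1r opprB.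
rewrite !e; have := sqrr_sign F n; rewrite -signr_odd.
move: (\prod_(0 <= i < n) (a - y i.+2)) (\prod_(0 <= i < n) (b - y i.+2))
  (\prod_(0 <= i < n) (c - y i.+2)) (\prod_(0 <= i < n) (d - y i.+2)) => A1 B1 C1 D1.
case: (odd n); rewrite ?expr0 ?expr1 => _; ring.
Qed.

End LambdaProducts.

(** * The average of the kernel over the roots of unity *)

Section KernelIdentities.
Variables (F : fieldType) (a b c d : F).
Hypotheses (a0 : a != 0) (b0 : b != 0) (c0 : c != 0) (d0 : d != 0).
Hypotheses (ab : a - b != 0) (ac : a - c != 0) (bd : b - d != 0).

Let db : d - b != 0. Proof. by rewrite -opprB oppr_eq0. Qed.
Let ca : c - a != 0. Proof. by rewrite -opprB oppr_eq0. Qed.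

(** Each of the four summands has its own symmetry: the first is antisymmetric in c and d, and the
    others lose all differences in their denominators when symmetrized under b and d, under a and c,
    or under both exchanges. Only Laurent monomials remain to be averaged. *)
Lemma kernel_split : c * d * (c - d) * (a - d) * (b - c) /
    (a * b * (a - b) * (a - c) * (b - d)) =
  (c * d * (c - d) / (a * b * (a - b)) + c * d * (c - d) / (a * b * (b - d))) +
  (- (c * d * (c - d) / (a * b * (a - c))) -
   c * d * (c - d) * (a - b) / (a * b * (a - c) * (b - d))).
Proof. by field; rewrite a0 b0 ab ac bd. Qed.

Lemma kernel_sym24 :
  c * d * (c - d) / (a * b * (b - d)) + c * b * (c - b) / (a * d * (d - b)) =
  (c / a + c * d / (a * b)) + (b * c / (a * d) + (- (c ^+ 2 / (a * b)) - c ^+ 2 / (a * d))).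
Proof. by field; rewrite a0 b0 d0 bd db. Qed.

Lemma kernel_sym13 :
  - (c * d * (c - d) / (a * b * (a - c))) - a * d * (a - d) / (c * b * (c - a)) =
  (d / b + a * d / (b * c)) + (c * d / (a * b) + (- (d ^+ 2 / (b * c)) - d ^+ 2 / (a * b))).
Proof. by field; rewrite a0 b0 c0 ac ca. Qed.

Lemma kernel_sym13_24 :
  - (c * d * (c - d) * (a - b) / (a * b * (a - c) * (b - d))) -
  (a * d * (a - d) * (c - b) / (c * b * (c - a) * (b - d))) +
  (- (c * b * (c - b) * (a - d) / (a * d * (a - c) * (d - b))) -
  (a * b * (a - b) * (c - d) / (c * d * (c - a) * (d - b)))) =
  - ((a / d + a / b) + (c / d + c / b)) + (- ((b / c + b / a) + (d / c + d / a)) +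
    (((a / c + c / a) + (b / d + d / b)) + (1 + 1))).
Proof. by field; rewrite a0 b0 c0 d0 ac bd db ca. Qed.

End KernelIdentities.

Section PermutationSums.
Variables (F : numFieldType) (N : nat) (x : 'I_N -> F).

Lemma sum_swap p q (G : 'S_N -> F) : \sum_s G (tperm p q * s)%g = \sum_s G s.
Proof. by rewrite [RHS](reindex_inj (mulgI (tperm p q))). Qed.

(* Summing h (x k) over all k gives 0, and the positions outside P contribute
   equally by symmetry: this trades a factor at a new position q for factors at
   the positions of P. *)
Lemma sum_extra_position (P : seq 'I_N) q (h : F -> F) (G : 'S_N -> F) :
    uniq P -> q \notin P -> \sum_k h (x k) = 0 ->
    (forall k, k \notin P -> forall s, G (tperm k q * s)%g = G s) ->
  \sum_s G s * (\sum_(p <- P) h (x (s p))) +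
    (N - size P)%:R * \sum_s G s * h (x (s q)) = 0.
Proof.
move=> uP qP h0 GP.
have : \sum_(s : 'S_N) G s * \sum_k h (x (s k)) = 0.
  apply: big1 => s _; rewrite (_ : \sum_k _ = 0) ?mulr0 // -[RHS]h0.
  by rewrite [RHS](reindex_inj (@perm_inj _ s)).
apply: etrans; rewrite mulr_sumr -big_split /=.
pose T := \sum_(s : 'S_N) G s * h (x (s q)).
have Tk k : k \notin P -> \sum_(s : 'S_N) G s * h (x (s k)) = T.
  move=> kP; rewrite -(sum_swap k q); apply: eq_bigr => s _.
  by rewrite GP // permM tpermL.
transitivity (\sum_(s : 'S_N) G s * (\sum_(p <- P) h (x (s p))) +
    \sum_(k | k \notin P) \sum_(s : 'S_N) G s * h (x (s k))).
  rewrite [X in _ = _ + X](eq_bigr (fun=> T)); last by move=> k; exact: Tk.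
  rewrite sumr_const big_split /= -mulr_sumr -/T mulr_natl; congr (_ + _ *+ _).
  rewrite -{1}(card_ord N) -(cardC (mem P)) (card_uniqP uP) addKn.
  by apply: eq_card => k; rewrite !inE.
rewrite exchange_big /= -big_split /=; apply: eq_bigr => s _.
rewrite -mulr_sumr -mulrDr; congr (_ * _); rewrite [RHS](bigID (mem P)) /=.
by rewrite big_uniq.
Qed.

Hypotheses (N4 : (3 < N)%N) (x_inj : injective x) (x_neq0 : forall k, x k != 0).
Hypotheses (sum_x : \sum_k x k = 0) (sum_xV : \sum_k (x k)^-1 = 0)
           (sum_x2 : \sum_k x k ^+ 2 = 0).

Let nz s p : x ((s : 'S_N) p) != 0.
Proof. exact: x_neq0. Qed.

Let swap_other k q p s : p != k -> p != q -> (tperm k q * s)%g p = s p :> 'I_N.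
Proof. by move=> pk pq; rewrite permM tpermD // eq_sym. Qed.

Let sum1 : \sum_(s : 'S_N) (1 : F) = N`!%:R.
Proof. by rewrite sumr_const card_Sn. Qed.

Lemma sum_ratio p q : p != q ->
  (N.-1)%:R * (\sum_(s : 'S_N) x (s p) / x (s q)) = - N`!%:R.
Proof.
move=> pq; have := @sum_extra_position [:: q] p id (fun s : 'S_N => (x (s q))^-1) isT.
rewrite inE pq => /(_ isT sum_x) /= H; apply/eqP; rewrite -addr_eq0 addrC; apply/eqP.
rewrite -[RHS]H => [|k kq s]; last first.
  by rewrite swap_other // 1?eq_sym //; move: kq; rewrite inE.
rewrite -sum1 subn1; congr (_ + _ * _); apply: eq_bigr => s _; last by rewrite mulrC.
by rewrite big_seq1 mulVf.
Qed.

Lemma sum_ratio2 p q : p != q ->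
  (N.-1)%:R * (\sum_(s : 'S_N) x (s p) ^+ 2 / x (s q) ^+ 2) = - N`!%:R.
Proof.
move=> pq; have := @sum_extra_position [:: q] p (fun t => t ^+ 2) (fun s : 'S_N => (x (s q))^-2) isT.
rewrite inE pq => /(_ isT sum_x2) /= H; apply/eqP; rewrite -addr_eq0 addrC; apply/eqP.
rewrite -[RHS]H => [|k kq s]; last first.
  by rewrite swap_other // 1?eq_sym //; move: kq; rewrite inE.
rewrite -sum1 subn1; congr (_ + _ * _); apply: eq_bigr => s _; last by rewrite mulrC.
by rewrite big_seq1 mulVf // expf_neq0.
Qed.

Lemma sum_square_ratio p q r : uniq [:: p; q; r] ->
  (N.-2)%:R * (\sum_(s : 'S_N) x (s p) ^+ 2 / (x (s q) * x (s r))) =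
  - (\sum_(s : 'S_N) x (s p) / x (s q) + \sum_(s : 'S_N) x (s p) ^+ 2 / x (s q) ^+ 2).
Proof.
rewrite /= !inE negb_or => /and3P[/andP[pq pr] qr _].
have := @sum_extra_position [:: p; q] r (fun t => t^-1) (fun s : 'S_N => x (s p) ^+ 2 / x (s q)).
rewrite /= !inE !negb_or pq ![r == _]eq_sym pr qr => /(_ isT isT sum_xV) H.
apply/eqP; rewrite -addr_eq0 addrC; apply/eqP; rewrite -[RHS]H => [|k + s]; last first.
  by rewrite !inE negb_or => /andP[kp kq]; rewrite !swap_other // eq_sym.
rewrite -big_split subn2; congr (_ + _ * _); apply: eq_bigr => s _.
  by rewrite big_cons big_seq1 /=; field; rewrite !nz.
by rewrite /=; field; rewrite !nz.
Qed.

Lemma sum_product_ratio p q r t : uniq [:: p; q; r; t] ->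
  (N - 3)%:R * (\sum_(s : 'S_N) x (s p) * x (s q) / (x (s r) * x (s t))) =
  - (\sum_(s : 'S_N) x (s p) ^+ 2 / (x (s r) * x (s t)) +
     (\sum_(s : 'S_N) x (s p) / x (s r) + \sum_(s : 'S_N) x (s p) / x (s t))).
Proof.
rewrite /= !inE !negb_or -!andbA => /and5P[pq pr pt qr /and3P[qt rt _]].
have := @sum_extra_position [:: p; r; t] q id (fun s : 'S_N => x (s p) / (x (s r) * x (s t))).
rewrite /= !inE !negb_or pr pt rt [q == p]eq_sym pq qr qt => /(_ isT isT sum_x) H.
apply/eqP; rewrite -addr_eq0 addrC; apply/eqP; rewrite -[RHS]H => [|k + s]; last first.
  by rewrite !inE !negb_or => /and3P[kp kr kt]; rewrite !swap_other // eq_sym.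
rewrite -!big_split; congr (_ + _ * _); apply: eq_bigr => s _.
  by rewrite !big_cons big_nil /=; field; rewrite !nz.
by field; rewrite !nz.
Qed.

(** A is the sum over all orderings of x_p / x_q; B is that of x_p^2 / (x_q x_r) and also that of
    x_p x_q / (x_r x_t). Thanks to this coincidence B drops out of the sums below. *)
Let A := - N`!%:R / (N.-1)%:R : F.
Let B := - (A + A) / (N.-2)%:R : F.

Let N1 : (N.-1)%:R != 0 :> F. Proof. by rewrite pnatr_eq0; lia. Qed.
Let N2 : (N.-2)%:R != 0 :> F. Proof. by rewrite pnatr_eq0; lia. Qed.
Let N3 : (N - 3)%:R != 0 :> F. Proof. by rewrite pnatr_eq0; lia. Qed.

Let ratioE p q : p != q -> \sum_(s : 'S_N) x (s p) / x (s q) = A.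
Proof. by move=> pq; apply: (mulfI N1); rewrite sum_ratio // /A mulrC divfK. Qed.

Let squareE p q r : uniq [:: p; q; r] ->
  \sum_(s : 'S_N) x (s p) ^+ 2 / (x (s q) * x (s r)) = B.
Proof.
move=> u; have pq : p != q by move: u; rewrite /= !inE negb_or => /andP[/andP[]].
apply: (mulfI N2); rewrite sum_square_ratio // ratioE // /B [RHS]mulrC divfK //.
by congr (- (_ + _)); apply: (mulfI N1); rewrite sum_ratio2 // /A [RHS]mulrC divfK.
Qed.

Let productE p q r t : uniq [:: p; q; r; t] ->
  \sum_(s : 'S_N) x (s p) * x (s q) / (x (s r) * x (s t)) = B.
Proof.
move=> u; move: (u); rewrite /= !inE !negb_or -!andbA => /and5P[pq pr pt qr /and3P[qt rt _]].
apply: (mulfI N3); rewrite sum_product_ratio // squareE ?ratioE //; last first.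
  by rewrite /= !inE negb_or pr pt rt.
have -> : A + A = - ((N.-2)%:R * B) by rewrite /B [_ * (_ / _)]mulrC divfK ?opprK.
have -> : (N.-2)%:R = (N - 3)%:R + 1 :> F by rewrite natr1; congr _%:R; lia.
by ring.
Qed.

Variables p1 p2 p3 p4 : 'I_N.
Hypothesis up : uniq [:: p1; p2; p3; p4].

Let sum4 (f : F -> F -> F -> F -> F) : F :=
  \sum_(s : 'S_N) f (x (s p1)) (x (s p2)) (x (s p3)) (x (s p4)).

Let ds : [/\ p1 != p2, p1 != p3, p1 != p4, p2 != p3 & p2 != p4 /\ p3 != p4].
Proof.
by move: up; rewrite /= !inE !negb_or -!andbA => /and5P[? ? ? ? /and3P[? ? _]].
Qed.

Let sum4_swap13 f : sum4 f = sum4 (fun a b c d => f c b a d).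
Proof.
have [d12 d13 d14 d23 [d24 d34]] := ds.
rewrite /sum4 -(sum_swap p1 p3); apply: eq_bigr => s _.
by rewrite !permM tpermL tpermR !tpermD // eq_sym.
Qed.

Let sum4_swap24 f : sum4 f = sum4 (fun a b c d => f a d c b).
Proof.
have [d12 d13 d14 d23 [d24 d34]] := ds.
rewrite /sum4 -(sum_swap p2 p4); apply: eq_bigr => s _.
by rewrite !permM tpermL tpermR !tpermD // eq_sym.
Qed.

Let sum4_swap34 f : sum4 f = sum4 (fun a b c d => f a b d c).
Proof.
have [d12 d13 d14 d23 [d24 d34]] := ds.
rewrite /sum4 -(sum_swap p3 p4); apply: eq_bigr => s _.
by rewrite !permM tpermL tpermR !tpermD // eq_sym.
Qed.

Let sum4D f g : sum4 f + sum4 g = sum4 (fun a b c d => f a b c d + g a b c d).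
Proof. by rewrite -big_split. Qed.

Let eq_sum4 f g : (forall a b c d : F, [/\ a != 0, b != 0, c != 0 & d != 0] ->
    [/\ a - b != 0, a - c != 0 & b - d != 0] ->
    f a b c d = g a b c d) -> sum4 f = sum4 g.
Proof.
have [d12 d13 d14 d23 [d24 d34]] := ds.
move=> fg; apply: eq_bigr => s _; apply: fg; split; rewrite ?x_neq0 //;
  by rewrite subr_eq0 (inj_eq x_inj) (inj_eq perm_inj).
Qed.

(** The A from the second and third summands cancel those from the fourth; what survives comes from
    the constant 1 + 1 of [kernel_sym13_24], and the average is 1/2. *)
Lemma sum4_kernel :
  2 * sum4 (fun a b c d => c * d * (c - d) * (a - d) * (b - c) /
    (a * b * (a - b) * (a - c) * (b - d))) = N`!%:R.
Proof.
have [d12 d13 d14 d23 [d24 d34]] := ds.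
have [d21 d31 d41 d32 [d42 d43]] :
    [/\ p2 != p1, p3 != p1, p4 != p1, p3 != p2 & p4 != p2 /\ p4 != p3].
  by split; [| | | |split]; rewrite eq_sym.
pose T1 (a b c d : F) := c * d * (c - d) / (a * b * (a - b)).
pose T2 (a b c d : F) := c * d * (c - d) / (a * b * (b - d)).
pose T3 (a b c d : F) := - (c * d * (c - d) / (a * b * (a - c))).
pose T4 (a b c d : F) := - (c * d * (c - d) * (a - b) / (a * b * (a - c) * (b - d))).
have T1E : sum4 T1 = 0.
  have : sum4 T1 + sum4 T1 = 0.
    rewrite {2}sum4_swap34 sum4D /sum4 big1 // => s _; rewrite /T1.
    by rewrite -mulrDl [X in X / _](_ : _ = 0) ?mul0r //; ring.
  by move/eqP; rewrite -mulr2n mulrn_eq0 => /eqP.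
have T2E : sum4 T2 + sum4 T2 = A.
  rewrite {2}sum4_swap24 sum4D.
  rewrite (@eq_sum4 _ (fun a b c d => (c / a + c * d / (a * b)) + (b * c / (a * d)
    + (- (c ^+ 2 / (a * b)) - c ^+ 2 / (a * d))))); last first.
    by move=> a b c d [a0 b0 c0 d0] [ab ac bd]; exact: kernel_sym24.
  rewrite -!sum4D /sum4 !sumrN ratioE // !squareE ?productE //=;
    by rewrite ?inE ?negb_or ?(d12, d13, d14, d23, d24, d34, d21, d31, d41, d32, d42, d43) //; ring.
have T3E : sum4 T3 + sum4 T3 = A.
  rewrite {2}sum4_swap13 sum4D.
  rewrite (@eq_sum4 _ (fun a b c d => (d / b + a * d / (b * c)) + (c * d / (a * b)
    + (- (d ^+ 2 / (b * c)) - d ^+ 2 / (a * b))))); last first.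
    by move=> a b c d [a0 b0 c0 d0] [ab ac bd]; exact: kernel_sym13.
  rewrite -!sum4D /sum4 !sumrN ratioE // !squareE ?productE //=;
    by rewrite ?inE ?negb_or ?(d12, d13, d14, d23, d24, d34, d21, d31, d41, d32, d42, d43) //; ring.
have T4E : (sum4 T4 + sum4 T4) + (sum4 T4 + sum4 T4) = - (A *+ 4) + N`!%:R *+ 2.
  have e13 := sum4_swap13 T4; have e24 := sum4_swap24 T4.
  have e1324 : sum4 T4 = sum4 (fun a b c d => T4 c d a b).
    by rewrite e13 sum4_swap24.
  transitivity ((sum4 T4 + sum4 (fun a b c d => T4 c b a d)) +
    (sum4 (fun a b c d => T4 a d c b) + sum4 (fun a b c d => T4 c d a b))).
    by rewrite -e13 -e24 -e1324.
  rewrite !sum4D.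
  rewrite (@eq_sum4 _ (fun a b c d =>
    - ((a / d + a / b) + (c / d + c / b)) +
    (- ((b / c + b / a) + (d / c + d / a)) +
    (((a / c + c / a) + (b / d + d / b)) + (1 + 1))))); last first.
    by move=> a b c d [a0 b0 c0 d0] [ab ac bd]; exact: kernel_sym13_24.
  rewrite -!sum4D /sum4 !sumrN !big_split /= !ratioE // sum1.
  by ring.
rewrite (@eq_sum4 _ (fun a b c d => (T1 a b c d + T2 a b c d) + (T3 a b c d + T4 a b c d)));
  last first.
  by move=> a b c d [a0 b0 c0 d0] [ab ac bd]; exact: kernel_split.
rewrite -!sum4D T1E add0r.
have n2 : (2 : F) != 0 by rewrite pnatr_eq0.
apply: (mulfI n2); transitivity ((sum4 T2 + sum4 T2) *+ 2 + (sum4 T3 + sum4 T3) *+ 2 +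
  ((sum4 T4 + sum4 T4) + (sum4 T4 + sum4 T4))); first by ring.
by rewrite T2E T3E T4E; ring.
Qed.

End PermutationSums.

(** * The value of the inner product *)

Section LambdaValue.
Variable F : numClosedFieldType.

Definition lam_pairs n : seq ('I_n * 'I_n) :=
  [seq p : 'I_n * 'I_n <- enum {: 'I_n * 'I_n} | lam n p.1 p.2].

Lemma lam_prodE (K : comNzRingType) n (y : nat -> K) :
  lam_prod n y = \prod_(p <- lam_pairs n) (y p.1 - y p.2).
Proof.
rewrite /lam_pairs big_filter big_enum_cond.
transitivity (\prod_(i < n) \prod_(j < n | lam n i j) (y i - y j)); last by rewrite pair_big_dep.
by rewrite /lam_prod big_mkord; apply: eq_bigr => i _; rewrite big_mkord.
Qed.

Lemma vdmE (K : comNzRingType) n (y : nat -> K) :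
  vdm n y = vandermonde (fun i : 'I_n => y i).
Proof. by rewrite /vdm big_mkord; apply: eq_bigr => i _; rewrite big_mkord. Qed.

Lemma vandermonde_perm (K : comNzRingType) n (x : 'I_n -> K) (s : 'S_n) :
  vandermonde (fun i => x (s i)) = (-1) ^+ s * vandermonde x.
Proof.
rewrite !vandermonde_expand mulr_sumr (reindex_inj (mulIg s^-1%g)) /=.
apply: eq_bigr => t _; rewrite odd_permM odd_permV signr_addb [(-1) ^+ t * _]mulrC -mulrA.
by congr (_ * (_ * _)); apply: eq_bigr => i _; rewrite permM permKV.
Qed.

Lemma vandermonde_neq0 (K : idomainType) n (x : 'I_n -> K) :
  injective x -> vandermonde x != 0.
Proof.
move=> xi; apply/prodf_neq0 => i _; apply/prodf_neq0 => j ij.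
by rewrite subr_eq0 (inj_eq xi); apply: contraTneq ij => ->; rewrite ltnn.
Qed.

Definition lam_value n : int := stair_coef (pair_poly int (lam_pairs n)).

Definition on_nat n (x : 'I_n -> F) (i : nat) : F := oapp x 0 (insub i).

Lemma on_natE n (x : 'I_n -> F) (i : 'I_n) : on_nat x i = x i.
Proof. by rewrite /on_nat valK. Qed.

Definition ratio n (y : nat -> F) : F := lam_prod n y / vdm n y.

Lemma eq_ratio n (y y' : nat -> F) : (forall i, (i < n)%N -> y i = y' i) ->
  ratio n y = ratio n y'.
Proof.
move=> e; rewrite /ratio !vdmE !lam_prodE; congr (_ / _).
  by apply: eq_bigr => p _; rewrite !e.
by rewrite /vandermonde; apply: eq_bigr => i _; apply: eq_bigr => j _; rewrite !e.
Qed.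

(** Reordering the points multiplies their Vandermonde product by the sign of s, so dividing by it
    absorbs the signs of the alternant. The result does not depend on the points. *)
Lemma sum_ratio_perm n (x : 'I_n -> F) :
    size (lam_pairs n) = (\sum_(i < n) i)%N -> injective x ->
  \sum_(s : 'S_n) ratio n (on_nat (fun i => x (s i))) = (lam_value n)%:~R.
Proof.
move=> sz xi; rewrite /lam_value -stair_coef_int.
apply: (mulIf (vandermonde_neq0 xi)); rewrite -alternant_hom => [|m /pair_poly_hom ->//].
rewrite mulr_suml; apply: eq_bigr => s _.
rewrite /ratio vdmE lam_prodE.
have -> : vandermonde (fun i : 'I_n => on_nat (fun i => x (s i)) i) = (-1) ^+ s * vandermonde x.
  rewrite -vandermonde_perm /vandermonde.
  by apply: eq_bigr => i _; apply: eq_bigr => j _; rewrite !on_natE.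
rewrite meval_pair_poly invfM -!mulrA mulVf ?vandermonde_neq0 // mulr1 mulrC.
rewrite invr_sign; congr (_ * _).
by apply: eq_bigr => p _; rewrite !on_natE.
Qed.

End LambdaValue.

Lemma big_addn_split4 n (g : nat -> nat) : (\sum_(0 <= i < n.+4) g i =
  g 0 + g 1 + g n.+2 + g n.+3 + \sum_(0 <= i < n) g i.+2)%N.
Proof.
rewrite big_nat_recl // big_nat_recl // big_nat_recr // big_nat_recr //=.
by rewrite !addnA; lia.
Qed.

(** This is the degree that [alternant_hom] requires. The outer rows and columns contribute 4k + 6 =
    k + (k+1) + (k+2) + (k+3) positions at each step from k to k + 4. *)
Lemma size_lam_pairs n : size (lam_pairs n) = (\sum_(i < n) i)%N.
Proof.
pose cnt n := (\sum_(0 <= i < n) \sum_(0 <= j < n) lam n i j)%N.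
have szE k : size (lam_pairs k) = cnt k.
  rewrite -sum1_size /lam_pairs big_filter big_enum_cond big_mkcond /cnt big_mkord.
  rewrite -(pair_big_dep xpredT (fun _ _ => true) (fun i j : 'I_k => if lam k i j then 1 else 0)%N) /=.
  by apply: eq_bigr => i _; rewrite big_mkord; apply: eq_bigr => j _; case: lam.
have big_const (k c : nat) (g : nat -> nat) : (forall i, (i < k)%N -> g i = c) ->
    (\sum_(0 <= i < k) g i = k * c)%N.
  by move=> h; rewrite (eq_big_nat _ _ (F2 := fun=> c)) ?sum_nat_const_nat ?subn0.
have cntE k : cnt k.+4 = (cnt k + (4 * k + 6))%N.
  rewrite /cnt big_addn_split4 !big_addn_split4.
  rewrite !lam_row0 ?lam_row1 ?lam_col0 ?lam_col1; try lia.
  rewrite !lam_last ?lam_last_col; try lia.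
  rewrite (@big_const k 1%N (fun i => lam k.+4 0 i.+2)) => [|i ki]; last by rewrite lam_row0; lia.
  rewrite (@big_const k 1%N (fun i => lam k.+4 1 i.+2)) => [|i ki]; last by rewrite lam_row1; lia.
  rewrite (@big_const k 0%N (fun i => lam k.+4 k.+2 i.+2)) => [|i ki]; last by rewrite lam_last; lia.
  rewrite (@big_const k 0%N (fun i => lam k.+4 k.+3 i.+2)) => [|i ki]; last by rewrite lam_last; lia.
  have -> : (\sum_(0 <= i < k) \sum_(0 <= j < k.+4) lam k.+4 i.+2 j =
     k * 2 + \sum_(0 <= i < k) \sum_(0 <= j < k) lam k i j)%N.
    rewrite -(@big_const k 2%N (fun=> 2%N)) // -big_split /=.
    apply: eq_big_nat => i /andP[_ ki]; rewrite big_addn_split4.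
    rewrite lam_col0 ?lam_col1 ?lam_last_col; try lia.
    have -> : (\sum_(0 <= j < k) lam k.+4 i.+2 j.+2 = \sum_(0 <= j < k) lam k i j)%N.
      by apply: eq_big_nat => j /andP[_ kj]; rewrite lam_shift.
    lia.
  lia.
rewrite szE; have [k] := ubnP n; elim: k n => // k IH n; rewrite ltnS => nk.
case: n nk => [|[|[|[|n]]]] nk; last first.
- have nk' : (n < k)%N by lia.
  by rewrite cntE (IH _ nk') !big_ord_recr /=; lia.
- by rewrite /cnt !big_mkord !big_ord_recr !big_ord0 /= !big_mkord !big_ord_recr !big_ord0.
- by rewrite /cnt !big_mkord !big_ord_recr !big_ord0 /= !big_mkord !big_ord_recr !big_ord0.
- by rewrite /cnt !big_mkord !big_ord_recr !big_ord0 /= !big_mkord !big_ord_recr !big_ord0.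
- by rewrite /cnt big_nil big_ord0.
Qed.

(** * The recursion evaluated at roots of unity *)

Section RootsOfUnity.
Variables (F : numClosedFieldType) (N : nat) (w : F).
Hypothesis wP : N.-primitive_root w.
Hypothesis N3 : (2 < N)%N.

Definition root_of (i : 'I_N) : F := w ^+ i.

Lemma root_of_inj : injective root_of.
Proof.
move=> i j /eqP; rewrite /root_of (eq_prim_root_expr wP) !modn_small // => /eqP.
exact: val_inj.
Qed.

Lemma root_of_neq0 i : root_of i != 0.
Proof.
rewrite expf_neq0 //; apply/eqP => w0; have /eqP := prim_expr_order wP.
by rewrite w0 expr0n (gtn_eqF (prim_order_gt0 wP)) eq_sym oner_eq0.
Qed.

Lemma sum_geometric0 (v : F) : v ^+ N = 1 -> v != 1 -> \sum_(i < N) v ^+ i = 0.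
Proof.
move=> vN v1; have := subrX1 v N; rewrite vN subrr => /esym/eqP.
by rewrite mulf_eq0 subr_eq0 (negbTE v1) => /eqP.
Qed.

Let w_neq1 k : (0 < k < N)%N -> w ^+ k != 1.
Proof.
move=> /andP[k0 kN]; rewrite -(expr0 w) (eq_prim_root_expr wP) mod0n modn_small //.
by rewrite -lt0n.
Qed.

Lemma sum_root : \sum_i root_of i = 0.
Proof. by apply: sum_geometric0; [exact: prim_expr_order|rewrite -[w]expr1 w_neq1 //; lia]. Qed.

Lemma sum_rootV : \sum_i (root_of i)^-1 = 0.
Proof.
under eq_bigr do rewrite /root_of -exprVn.
apply: sum_geometric0; first by rewrite exprVn (prim_expr_order wP) invr1.
by rewrite invr_eq1 -[w]expr1 w_neq1 //; lia.
Qed.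

Lemma sum_root2 : \sum_i root_of i ^+ 2 = 0.
Proof.
under eq_bigr do rewrite /root_of exprAC.
apply: sum_geometric0; last by rewrite w_neq1 //; lia.
by rewrite exprAC (prim_expr_order wP) expr1n.
Qed.

(** The product is the derivative of X^N - 1 at the root. *)
Lemma prod_root_diff (s : 'S_N) (i : 'I_N) :
  \prod_(j | j != i) (root_of (s i) - root_of (s j)) = N%:R / root_of (s i).
Proof.
have e : \prod_j ('X - (root_of (s j))%:P) = 'X^N - 1.
  rewrite -(factor_Xn_sub_1 wP) big_mkord [RHS](reindex_inj (@perm_inj _ s)) //.
have := congr1 (fun p => p^`().[root_of (s i)]) e.
rewrite (bigD1 i) //= derivM derivB derivX derivC subr0 mul1r hornerD hornerM.
rewrite hornerXsubC subrr mul0r addr0 horner_prod derivB derivXn -(polyC1 F) derivC subr0.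
rewrite hornerMn hornerXn => e'.
transitivity (root_of (s i) ^+ N.-1 *+ N).
  by rewrite -e'; apply: eq_bigr => j _; rewrite hornerXsubC.
have rN : root_of (s i) ^+ N = 1 by rewrite /root_of exprAC (prim_expr_order wP) expr1n.
rewrite -mulr_natl; congr (_ * _); apply: (mulfI (root_of_neq0 (s i))).
by rewrite -exprS prednK ?rN ?divff ?root_of_neq0 //; lia.
Qed.

End RootsOfUnity.

Section RatioStep.
Variables (F : numFieldType) (n : nat).

Definition kernel (a b c d : F) : F :=
  c * d * (c - d) * (a - d) * (b - c) / (a * b * (a - b) * (a - c) * (b - d)).

(** The middle points enter the border factors only through the products Q of their differences from
    a, b, c and d. The hypothesis on [D] expresses each Q by the four outer values alone. *)
Lemma ratio_step (y : nat -> F) (a := y 0%N) (b := y 1%N) (c := y n.+2) (d := y n.+3)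
    (D : nat -> F := fun i => \prod_(0 <= j < n.+4 | j != i) (y i - y j)) :
    (forall i j, (i < n.+4)%N -> (j < n.+4)%N -> i != j -> y i - y j != 0) ->
    (forall i, (i < n.+4)%N -> y i != 0) ->
    (forall i, (i < n.+4)%N -> D i = n.+4%:R / y i) ->
  lam_prod n.+4 y / vdm n.+4 y =
    - kernel a b c d * (lam_prod n (fun k => y k.+2) / vdm n (fun k => y k.+2)).
Proof.
move=> yd y0 DE.
have n40 : (4 + n%:R : F) != 0 by rewrite -natrD pnatr_eq0.
have ab : a - b != 0 by apply: yd.
have ac : a - c != 0 by apply: yd => //; clear; lia.
have ad : a - d != 0 by apply: yd => //; clear; lia.
have bc : b - c != 0 by apply: yd => //; clear; lia.
have bd : b - d != 0 by apply: yd => //; clear; lia.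
have cd : c - d != 0 by apply: yd => //; clear; lia.
have opp u v : u - v != 0 -> v - u != 0 :> F by rewrite -opprB oppr_eq0.
have [ba ca da] : [/\ b - a != 0, c - a != 0 & d - a != 0] by split; apply: opp.
have [cb db dc] : [/\ c - b != 0, d - b != 0 & d - c != 0] by split; apply: opp.
have a0 : a != 0 by apply: y0.
have b0 : b != 0 by apply: y0.
have c0 : c != 0 by apply: y0; clear; lia.
have d0 : d != 0 by apply: y0; clear; lia.
pose Q u := \prod_(0 <= k < n) (u - y k.+2).
have Qn0 i : (i < n.+4)%N -> (forall k, (k < n)%N -> i != k.+2) -> Q (y i) != 0.
  move=> ni ik; rewrite /Q big_mkord; apply/prodf_neq0 => k _; apply: yd => //.
    by have := ltn_ord k; clear; lia.
  exact: ik.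
have split i : (forall k, (k < n)%N -> i != k.+2) ->
    \prod_(0 <= j < n | j.+2 != i) (y i - y j.+2) = Q (y i).
  by move=> ik; apply: prod_nat_true => k kn; rewrite eq_sym ik.
have Da : Q a = n.+4%:R / (a * ((a - b) * (a - c) * (a - d))).
  have := DE 0%N isT; rewrite /D big_nat_split4_cond /= -/a -/b -/c -/d.
  rewrite (split 0%N) // mul1r => /(canRL (mulKf _)) ->; last by rewrite !mulf_neq0.
  by field; rewrite a0 ab ac ad.
have Db : Q b = n.+4%:R / (b * ((b - a) * (b - c) * (b - d))).
  have := DE 1%N isT; rewrite /D big_nat_split4_cond /= -/a -/b -/c -/d.
  rewrite (split 1%N) // mulr1 => /(canRL (mulKf _)) ->; last by rewrite !mulf_neq0.
  by field; rewrite b0 ba bc bd.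
have nn : (n.+3 == n.+2) = false by clear; lia.
have nn' : (n.+2 == n.+3) = false by clear; lia.
have Dc : Q c = n.+4%:R / (c * ((c - a) * (c - b) * (c - d))).
  have lt2 : (n.+2 < n.+4)%N by clear; lia.
  have := DE n.+2; rewrite /D big_nat_split4_cond nn eqxx /= -/a -/b -/c -/d.
  rewrite (split n.+2) => [|k kn]; last by clear -kn; lia.
  rewrite mulr1 => /(_ lt2)/(canRL (mulKf _)) ->; last by rewrite !mulf_neq0.
  by field; rewrite c0 ca cb cd.
have Dd : Q d = n.+4%:R / (d * ((d - a) * (d - b) * (d - c))).
  have lt3 : (n.+3 < n.+4)%N by clear; lia.
  have := DE n.+3; rewrite /D big_nat_split4_cond nn' eqxx /= -/a -/b -/c -/d.
  rewrite (split n.+3) => [|k kn]; last by clear -kn; lia.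
  rewrite mulr1 => /(_ lt3)/(canRL (mulKf _)) ->; last by rewrite !mulf_neq0.
  by field; rewrite d0 da db dc.
rewrite lam_prod_rec vdm_rec -/a -/b -/c -/d !big_split /= -!/(Q _).
have Qa0 : Q a != 0 by apply: Qn0.
have Qb0 : Q b != 0 by apply: Qn0.
have Qc0 : Q c != 0 by apply: Qn0; [clear; lia|move=> k kn; clear -kn; lia].
have Qd0 : Q d != 0 by apply: Qn0; [clear; lia|move=> k kn; clear -kn; lia].
move: (lam_prod n _) => L; set V := vdm n _.
rewrite !invfM !mulrA; congr (_ * V^-1).
transitivity (L * (- ((a - b) * (a - d) * (b - c)) * (Q a * Q b) /
   ((a - c) * (b - d) * (c - d) * (Q c * Q d)))).
  by field; rewrite ?Qa0 ?Qb0 ?Qc0 ?Qd0 ?ab ?ac ?ad ?bc ?bd ?cd.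
rewrite Da Db Dc Dd /kernel mulrC; congr (_ * _).
by field; rewrite a0 b0 c0 d0 n40 ?ab ?ac ?ad ?bc ?bd ?cd ?ba ?ca ?da ?cb ?db ?dc.
Qed.

End RatioStep.

Section EmbedPerm.
Variable n : nat.

Lemma mid_subproof (k : 'I_n) : (k.+2 < n.+4)%N.
Proof. by have := ltn_ord k; lia. Qed.

Definition mid (k : 'I_n) : 'I_n.+4 := Ordinal (mid_subproof k).

(** The default of [oapp] is reached exactly at the last two positions, which have to stay fixed. *)
Definition mid_map (t : 'S_n) (i : 'I_n.+4) : 'I_n.+4 :=
  if (2 <= i)%N then oapp (fun k => mid (t k)) i (insub (i - 2)%N) else i.

Lemma mid_map_mid t k : mid_map t (mid k) = mid (t k).
Proof. by rewrite /mid_map /= !subSS subn0 valK. Qed.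

Lemma mid_map_other t (i : 'I_n.+4) : (i < 2)%N || (n.+2 <= i)%N -> mid_map t i = i.
Proof.
move=> h; rewrite /mid_map; case: ifP => // i2.
by rewrite insubF //; move: h i2; clear; lia.
Qed.

Lemma mid_mapK t : cancel (mid_map t) (mid_map t^-1).
Proof.
move=> i; have [h|] := boolP ((i < 2)%N || (n.+2 <= i)%N).
  by rewrite !mid_map_other // mid_map_other.
rewrite negb_or -!leqNgt => /andP[i2 ni].
have ki : (i - 2 < n)%N by move: ni i2; clear; lia.
have -> : i = mid (Ordinal ki) by apply/val_inj => /=; move: i2; clear; lia.
by rewrite !mid_map_mid permK.
Qed.

Definition mid_perm t : 'S_n.+4 := perm (can_inj (mid_mapK t)).

End EmbedPerm.

Section ValueStep.
Variables (F : numClosedFieldType) (n : nat).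

Lemma lam_value_step :
  2 * n`!%:R * (lam_value n.+4)%:~R = - ((n.+4)`!%:R * (lam_value n)%:~R) :> F.
Proof.
have N0 : n.+4%:R != 0 :> F by rewrite pnatr_eq0.
have [w wP] := closed_prim_root_exists N0.
pose x := root_of (N := n.+4) w.
have xi : injective x by exact: root_of_inj.
have x0 k : x k != 0 by exact: root_of_neq0.
pose y (s : 'S_n.+4) := on_nat (fun i => x (s i)).
have yE s (i : 'I_n.+4) : y s i = x (s i) by exact: on_natE.
have l1 : (1 < n.+4)%N by [].
have l2 : (n.+2 < n.+4)%N by clear; lia.
have l3 : (n.+3 < n.+4)%N by clear; lia.
pose p1 : 'I_n.+4 := ord0; pose p2 := Ordinal l1; pose p3 := Ordinal l2; pose p4 := Ordinal l3.
pose K (s : 'S_n.+4) := kernel (x (s p1)) (x (s p2)) (x (s p3)) (x (s p4)).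
pose g (s : 'S_n.+4) := ratio n (fun k => y s k.+2).
have stepE s : ratio n.+4 (y s) = - K s * g s.
  rewrite /ratio ratio_step => [|i j ni nj ij|i ni|i ni].
  - by rewrite /K -(yE s p1) -(yE s p2) -(yE s p3) -(yE s p4).
  - rewrite (yE s (Ordinal ni) : y s i = _) (yE s (Ordinal nj) : y s j = _) subr_eq0.
    by rewrite (inj_eq xi) (inj_eq perm_inj).
  - by rewrite (yE s (Ordinal ni) : y s i = _).
  rewrite (yE s (Ordinal ni) : y s i = _) -(prod_root_diff wP) // big_mkord.
  by apply: eq_big => [//|j _]; rewrite yE.
have sumK : 2 * \sum_s K s = (n.+4)`!%:R.
  apply: (sum4_kernel (x := x)) => //.
  - by apply: sum_root => //.
  - by apply: sum_rootV => //.
  - by apply: sum_root2 => //.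
  - by rewrite /= !inE -!val_eqE /=; clear; lia.
have KP t s : K (mid_perm t * s)%g = K s.
  by rewrite /K !permM ![mid_perm t _]permE !mid_map_other //= ?leqnn ?leqnSn ?orbT.
have gP s : \sum_(t : 'S_n) g (mid_perm t * s)%g = (lam_value n)%:~R.
  rewrite -(@sum_ratio_perm _ n (fun k => x (s (mid k)))); last 2 first.
  - exact: size_lam_pairs.
  - by move=> k l /xi /perm_inj /(congr1 val) /= [] /val_inj.
  apply: eq_bigr => t _; apply: eq_ratio => i ni.
  rewrite (on_natE _ (Ordinal ni) : on_nat _ i = _).
  rewrite (yE _ (mid (Ordinal ni)) : y _ i.+2 = _) permM.
  by rewrite [mid_perm t _]permE mid_map_mid.
(* Permuting only the middle positions leaves K unchanged and sums g to [lam_value n]. The n middle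
   roots are not the n-th roots of unity, but by [sum_ratio_perm] any distinct points give this
   value. *)
have avg : n`!%:R * \sum_s K s * g s = (\sum_s K s) * (lam_value n)%:~R.
  rewrite -{1}(card_Sn n) mulr_natl -sumr_const mulr_suml.
  transitivity (\sum_(t : 'S_n) \sum_s K s * g (mid_perm t * s)%g).
    apply: eq_bigr => t _; rewrite (reindex_inj (mulgI (mid_perm t))) /=.
    by apply: eq_bigr => s _; rewrite KP.
  rewrite exchange_big /=; apply: eq_bigr => s _.
  by rewrite -mulr_sumr gP.
rewrite -(@sum_ratio_perm F n.+4 x (size_lam_pairs _) xi).
rewrite (eq_bigr _ (fun s _ => stepE s)).
under eq_bigr do rewrite mulNr.
by rewrite sumrN mulrN -mulrA avg mulrA sumK.
Qed.

End ValueStep.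

Lemma ratio3 (F : fieldType) (y : nat -> F) : y 0%N != y 1%N -> y 0%N != y 2%N -> y 1%N != y 2%N ->
  lam_prod 3 y / vdm 3 y = (y 2%N - y 0%N) / (y 1%N - y 2%N).
Proof.
rewrite -![y _ == y _]subr_eq0 => y01 y02 y12.
rewrite /lam_prod /vdm unlock /= !mulr1 !mul1r.
by field; rewrite y01 y02 y12.
Qed.

Section ClosedForm.
Variable F : numClosedFieldType.

Lemma natr_ord_inj n : injective (fun i : 'I_n => (i : nat)%:R : F).
Proof. by move=> i j /eqP; rewrite eqr_nat => /eqP/val_inj. Qed.

Lemma lam_value_small n : (n < 3)%N -> (lam_value n)%:~R = n`!%:R :> F.
Proof.
move=> n3; rewrite -(sum_ratio_perm (size_lam_pairs n) (@natr_ord_inj n)).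
rewrite -(card_Sn n) -sumr_const; apply: eq_bigr => s _.
case: n n3 s => [|[|[|//]]] _ s.
- by rewrite /ratio /lam_prod /vdm !big_nil divr1.
- by rewrite /ratio /lam_prod /vdm unlock /= !mulr1 divr1.
rewrite /ratio /lam_prod /vdm unlock /= !mulr1 divff //.
rewrite (on_natE _ (0 : 'I_2)) (on_natE _ (1 : 'I_2)) subr_eq0.
by rewrite (inj_eq (@natr_ord_inj 2)) (inj_eq perm_inj).
Qed.

Lemma lam_value3 : 2 * (lam_value 3)%:~R = - 6 :> F.
Proof.
pose x (i : 'I_3) := i%:R : F.
have xi : injective x by exact: natr_ord_inj.
pose i0 : 'I_3 := 0; pose i1 : 'I_3 := 1; pose i2 : 'I_3 := 2.
pose T (s : 'S_3) := (x (s i2) - x (s i0)) / (x (s i1) - x (s i2)).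
have xd (s : 'S_3) i j : i != j -> x (s i) - x (s j) != 0.
  by move=> ij; rewrite subr_eq0 (inj_eq xi) (inj_eq perm_inj).
have TE (s : 'S_3) : ratio 3 (on_nat (fun i => x (s i))) = T s.
  rewrite /ratio ratio3; rewrite ?(on_natE _ i0) ?(on_natE _ i1) ?(on_natE _ i2) //.
  - by rewrite -subr_eq0 xd.
  - by rewrite -subr_eq0 xd.
  - by rewrite -subr_eq0 xd.
rewrite -(sum_ratio_perm (size_lam_pairs 3) xi) (eq_bigr T) => [|s _]; last exact: TE.
(* Pairing s with its exchange of the last two positions gives (c - a)/(b - c) + (b - a)/(c - b) =
   -1. *)
rewrite mulrDl mul1r -{2}(sum_swap i1 i2) -big_split /=.
rewrite (eq_bigr (fun=> -1)) => [|s _].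
  by rewrite sumr_const card_Sn -mulNrn.
rewrite /T !permM tpermL tpermR tpermD //.
have := xd s i1 i2 isT; have := xd s i2 i1 isT.
by move: (x _) (x _) (x _) => a b c ca ac; field; rewrite ca ac.
Qed.

Lemma lam_value_closed n :
  2 ^+ ((n + 1) %/ 4) * (lam_value n)%:~R = (-1) ^+ ((n + 1) %/ 4) * n`!%:R :> F.
Proof.
have [k] := ubnP n; elim: k n => // k IH n; rewrite ltnS => nk.
have [n3|] := ltnP n 3.
  by rewrite divn_small ?lam_value_small ?mul1r //; lia.
rewrite leq_eqVlt => /predU1P[<-|n3]; first by rewrite expr1 lam_value3 expr1 mulN1r.
have [m nm] : exists m, n = m.+4 by exists (n - 4)%N; lia.
rewrite {}nm in nk *; have /IH := (ltnW (ltnW (ltnW nk)) : (m < k)%N).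
have -> : ((m.+4 + 1) %/ 4 = ((m + 1) %/ 4).+1)%N by lia.
move: (_ %/ _)%N => s e.
have m0 : m`!%:R != 0 :> F by rewrite pnatr_eq0 -lt0n fact_gt0.
apply: (mulfI m0); rewrite !exprS.
transitivity (2 ^+ s * (2 * m`!%:R * (lam_value m.+4)%:~R : F)); first by ring.
rewrite lam_value_step mulrN mulrCA e; ring.
Qed.

End ClosedForm.

Lemma mem_Lambda n (p : nat * nat) : (p \in Lambda n) =
  [&& 0 < p.1 <= n, 0 < p.2 <= n & lam n p.1.-1 p.2.-1]%N.
Proof.
case: p => i j; rewrite /Lambda !inE /=.
have -> : ((i, j) \in [seq (i, j) | i <- iota 1 n, j <- iota 1 n]) =
    (0 < i <= n)%N && (0 < j <= n)%N.
  apply/allpairsP/andP => [[[k l] /= []]|[hi hj]].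
    by rewrite !mem_iota => hk hl [-> ->]; split; lia.
  by exists (i, j); rewrite /= !mem_iota; split=> //; lia.
case: i j => [|i] [|j] /=; rewrite ?andbF //.
rewrite /lam eqSS -!andbA; congr [&& _, _, _ & _].
by rewrite addSn addnS addn2.
Qed.

Lemma perm_lam_pairs n : perm_eq [seq (p.1.+1, p.2.+1) | p : 'I_n * 'I_n <- lam_pairs n] (Lambda n).
Proof.
apply: uniq_perm.
- rewrite map_inj_uniq; first exact: (filter_uniq _ (enum_uniq _)).
  by move=> [i j] [k l] /= [] /val_inj -> /val_inj ->.
- exact: fset_uniq.
move=> [i j]; rewrite mem_Lambda; apply/mapP/and3P => /= [[[k l]]|[/andP[i0 ni] /andP[j0 nj] h]].
  by rewrite mem_filter /= => /andP[h _] [-> ->]; rewrite /= !ltn_ord.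
rewrite -(ltn_predK i0) -(ltn_predK j0) in ni nj *.
by exists (Ordinal ni, Ordinal nj); rewrite // mem_filter mem_enum h.
Qed.

Lemma Lambda_in_square n : in_square n (Lambda n).
Proof. by move=> i j; rewrite mem_Lambda => /and3P[? ? _]. Qed.

Lemma inner_Lambda (R : realType) n (s := ((n + 1) %/ 4)%N) :
  inner (chi_pattern R (Lambda n)) (chi R n) = (-1) ^+ s * (n`!%:R / 2 ^+ s).
Proof.
rewrite (inner_pair_poly _ (perm_lam_pairs n)) -/(lam_value n).
have s2 : 2 ^+ s != 0 :> R by rewrite expf_neq0 // pnatr_eq0.
rewrite mulrA; apply: (canRL (mulfK s2)); rewrite mulrC.
apply: (fmorph_inj (real_complex R)).
rewrite rmorphM rmorphXn rmorph_int rmorph_nat lam_value_closed.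
by rewrite rmorphM rmorph_sign rmorph_nat.
Qed.

(** * Universality *)

Lemma perm_codom_perm (A : finType) (T : eqType) (f g : A -> T) :
  perm_eq (codom f) (codom g) -> exists s : {perm A}, forall k, f k = g (s k).
Proof.
have szg : size (codom g) == #|A| by rewrite size_codom.
move=> /(@tuple_permP _ _ _ (Tuple szg))[p pE].
have si : injective (fun k => enum_val (p (enum_rank k)) : A).
  by move=> k l /enum_val_inj/perm_inj/enum_rank_inj.
exists (perm si) => k; rewrite permE.
have := congr1 (fun s => nth (f k) s (enum_rank k)) pE.
rewrite nth_codom enum_rankK => ->.
by rewrite /= nth_mktuple (tnth_nth (f k)) /= nth_codom.
Qed.

(** * The permanent as a coefficient of a product of linear forms *)

Section WeightSum.
Variables n m : nat.
Local Notation A := ('I_n * 'I_m)%type.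
Variable W : A -> 'I_n -> int.

Definition equidistributed (f : A -> 'I_n) := [forall i, #|[pred k | f k == i]| == m].

Lemma equidistributed_fst (s : {perm A}) : equidistributed (fun k => (s k).1).
Proof.
apply/forallP => i; apply/eqP.
rewrite (_ : #|_| = #|[pred k : A | k.1 == i]|); last first.
  by rewrite -!sum1_card [RHS](reindex_inj (@perm_inj _ s)).
rewrite -sum1_card big_mkcond -(pair_big xpredT xpredT (fun a b => if a == i then 1 else 0)%N) /=.
rewrite (bigD1 i) //= eqxx sum_nat_const card_ord muln1 big1 ?addn0 // => j /negbTE ->.
by rewrite big1.
Qed.

Lemma perm_of_equidistributed f : equidistributed f ->
  exists s : {perm A}, forall k, f k = (s k).1.
Proof.
move=> fe; apply: perm_codom_perm; apply/allP => i _ /=.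
have cE (g : A -> 'I_n) : count_mem i (codom g) = #|[pred k | g k == i]|.
  by rewrite /codom /image_mem count_map -size_filter cardE enumT.
have ide := equidistributed_fst 1%g.
rewrite !cE (eqP (forallP fe i)); apply/eqP; rewrite -[LHS](eqP (forallP ide i)).
by apply: eq_card => k; rewrite !inE perm1.
Qed.

Lemma sum_perm_fst :
  \sum_(s : {perm A}) \prod_k W k (s k).1 =
  #|[pred t : {perm A} | [forall k, (t k).1 == k.1]]|%:R *
  \sum_(f : {ffun A -> 'I_n} | equidistributed f) \prod_k W k (f k).
Proof.
rewrite (partition_big (fun s : {perm A} => [ffun k => (s k).1]) (fun f => equidistributed f)) /=;
  last first.
  move=> s _; have := equidistributed_fst s; congr is_true; apply: eq_forallb => i.
  by congr (_ == _); apply: eq_card => k; rewrite !inE ffunE.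
rewrite mulr_sumr; apply: eq_bigr => f fe.
have [s sE] := perm_of_equidistributed fe.
rewrite mulr_natl -sumr_const (reindex_inj (mulgI s)) /=.
apply: eq_big => [t|t /eqP tf].
  rewrite inE; apply/eqP/forallP => [tf k|tf].
    have := congr1 (fun g : {ffun A -> 'I_n} => g (s^-1 k)%g) tf.
    by rewrite ffunE permM permKV sE permKV => ->.
  by apply/ffunP => k; rewrite ffunE permM sE (eqP (tf _)).
by apply: eq_bigr => k _; rewrite -tf ffunE.
Qed.

Lemma mcoeff_equidistributed : m = n.-1 ->
  mcoeff (top_expo n) (\prod_k \sum_i W k i *: mvar int i) =
  \sum_(f : {ffun A -> 'I_n} | equidistributed f) \prod_k W k (f k).
Proof.
move=> mn; rewrite bigA_distr_bigA raddf_sum /= [RHS]big_mkcond /=; apply: eq_bigr => f _.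
rewrite scaler_prod mcoeffZ.
have -> : \prod_k mvar int (f k) = mpolyX int (\big[@mnm_add n/@mnm0 n]_k mnm1 (f k)).
  by rewrite (big_morph (mpolyX int) (@mpolyXD _ _) (@mpolyX0 _ _)).
rewrite mcoeffX.
have -> : (\big[@mnm_add n/@mnm0 n]_k mnm1 (f k) == top_expo n) = equidistributed f.
  have cE i : (\big[@mnm_add n/@mnm0 n]_k mnm1 (f k)) i = #|[pred k | f k == i]|.
    rewrite mnm_sumE -sum1_card [RHS]big_mkcond; apply: eq_bigr => k _ /=.
    by rewrite mnm1E inE; case: eqP.
  apply/eqP/forallP => [e i|e].
    by rewrite -cE e /top_expo multinomE tnth_mktuple mn.
  by apply/mnmP => i; rewrite cE (eqP (e i)) /top_expo multinomE tnth_mktuple.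
by case: ifP => _; rewrite ?mulr1 ?mulr0.
Qed.

End WeightSum.

Lemma lam_value_neq0 (F : numClosedFieldType) n : lam_value n != 0.
Proof.
apply/eqP => e; have := lam_value_closed F n; rewrite e mulr0 => /esym/eqP.
by rewrite mulf_eq0 signr_eq0 pnatr_eq0 -leqn0 leqNgt fact_gt0.
Qed.

Lemma sum_ord_id n : (\sum_(i < n) i + \sum_(i < n) i = n * n.-1)%N.
Proof.
rewrite -(big_mkord xpredT id) bin2_sum; case: n => // n.
by have := mul_bin_diag n.+1 1; rewrite bin1 => e; rewrite /=; lia.
Qed.

Lemma size_lt_pairs n : size (lt_pairs n) = (\sum_(i < n) i)%N.
Proof.
rewrite -sum1_size /lt_pairs big_filter big_enum_cond.
rewrite -(pair_big_dep xpredT (fun i j : 'I_n => (i < j)%N) (fun _ _ => 1%N)) /=.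
rewrite (exchange_big_dep xpredT) //=; apply: eq_bigr => j _.
by rewrite -(big_ord_widen n (fun=> 1%N) (ltnW (ltn_ord j))) sum1_card card_ord.
Qed.

Section Equations.
Variable n : nat.
Local Notation A := ('I_n * 'I_n.-1)%type.

(** The list has exactly as many entries as A has elements, so the default is never reached. *)
Definition equation_pair (k : A) : 'I_n * 'I_n :=
  nth (k.1, k.1) (lam_pairs n ++ lt_pairs n) (enum_rank k).

Lemma codom_equation_pair : codom equation_pair = lam_pairs n ++ lt_pairs n.
Proof.
have sz : size (lam_pairs n ++ lt_pairs n) = #|{: A}|.
  by rewrite size_cat size_lam_pairs size_lt_pairs card_prod !card_ord sum_ord_id.
case E: (lam_pairs n ++ lt_pairs n) => [|p s].
  by apply: size0nil; rewrite size_codom -sz E.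
apply: (@eq_from_nth _ p) => [|i]; rewrite size_codom -E -sz // => li.
have li' : (i < #|{: A}|)%N by rewrite -sz.
rewrite (nth_codom p equation_pair (Ordinal li')) /equation_pair enum_valK.
exact: set_nth_default.
Qed.

Definition equation_weight (k : A) (i : 'I_n) : int :=
  ((equation_pair k).1 == i)%:R - ((equation_pair k).2 == i)%:R.

Lemma permanent_neq0 (F : numClosedFieldType) :
  \sum_(s : {perm A}) \prod_k equation_weight k (s k).1 != 0.
Proof.
rewrite (sum_perm_fst equation_weight) -mcoeff_equidistributed //.
rewrite mulf_neq0 //.
  rewrite pnatr_eq0 -lt0n; apply/card_gt0P; exists 1%g; rewrite inE.
  by apply/forallP => k; rewrite perm1.
have -> : \prod_k \sum_i equation_weight k i *: mvar int i =
    pair_poly int (lam_pairs n ++ lt_pairs n).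
  rewrite /pair_poly -codom_equation_pair big_image /=; apply: eq_bigr => k _.
  have delta j : \sum_i (j == i)%:R *: mvar int i = mvar int j.
    rewrite (bigD1 j) //= eqxx scale1r big1 ?addr0 // => i /negbTE ij.
    by rewrite eq_sym ij scale0r.
  by under eq_bigr do rewrite scalerBl; rewrite sumrB !delta.
by rewrite mcoeff_top_pair mulf_neq0 ?signr_eq0 //; exact: (lam_value_neq0 F).
Qed.

End Equations.

Section Normalization.
Variables (C : numClosedFieldType) (n : nat).
Local Open Scope sesquilinear_scope.
Implicit Types V X : 'M[C]_n.

Lemma form_entry V X i j :
  (V *m X *m V^t*) i j = \sum_b \sum_c X b c * (V i b * (V j c)^*).
Proof.
rewrite mxE exchange_big /=; apply: eq_bigr => c _; rewrite !mxE mulr_suml.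
by apply: eq_bigr => b _; rewrite mulrCA mulrA.
Qed.

Lemma gram_normalize V :
    (forall i, exists b, V i b != 0) ->
    (forall i j : 'I_n, (i < j)%N -> (V *m V^t*) i j = 0) ->
  exists r : 'rV[C]_n, diag_mx r *m V \is unitarymx.
Proof.
move=> V0 VV; pose N i := (V *m V^t*) i i.
have NE i : N i = \sum_b `|V i b| ^+ 2.
  by rewrite /N mxE; apply: eq_bigr => b _; rewrite !mxE normCK.
have N0 i : 0 < N i.
  have [b b0] := V0 i; rewrite NE (bigD1 b) //= ltr_pwDl ?sumr_ge0 //.
    by rewrite exprn_gt0 // normr_gt0.
  by move=> c _; rewrite exprn_ge0.
have VVe i j : i != j -> (V *m V^t*) i j = 0.
  rewrite neq_ltn => /orP[/VV //|ji].
  have := congr1 Num.conj (VV _ _ ji); rewrite rmorph0 => <-.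
  rewrite !mxE rmorph_sum; apply: eq_bigr => b _.
  by rewrite !mxE rmorphM /= conjCK mulrC.
exists (\row_i (sqrtC (N i))^-1); apply/unitarymxP/matrixP => i j.
rewrite trmx_mul map_mxM tr_diag_mx map_diag_mx -mulmxA [V *m _]mulmxA.
rewrite mul_mx_diag mul_diag_mx.
set W := V *m _.
have WN : W i i = N i by [].
have WV : i != j -> W i j = 0 by exact: VVe.
clearbody W; rewrite !mxE.
have [<-|ij] := eqVneq i j; last by rewrite WV // mul0r mulr0.
have s0 : sqrtC (N i) != 0 by rewrite sqrtC_eq0 gt_eqF.
have cs : ((sqrtC (N i))^-1)^* = (sqrtC (N i))^-1.
  by apply: conj_Creal; rewrite ger0_real // invr_ge0 sqrtC_ge0 ltW.
rewrite /= cs WN; have e := sqrtCK (N i); rewrite -[X in _ * (X * _)]e.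
by field.
Qed.

Lemma tr_unitary (U X : 'M[C]_n) : U \is unitarymx -> \tr (U *m X *m U^t*) = \tr X.
Proof.
by move=> /unitarymxP/mulmx1C Uu; rewrite -mulmxA mxtrace_mulC -mulmxA Uu mulmx1.
Qed.

End Normalization.

Section EquationIndex.
Variable n : nat.
Local Notation A := ('I_n * 'I_n.-1)%type.

Lemma equation_index (q : 'I_n * 'I_n) i : (i < size (lam_pairs n ++ lt_pairs n))%N ->
  exists k : A, enum_rank k = i :> nat /\ equation_pair k = nth q (lam_pairs n ++ lt_pairs n) i.
Proof.
move=> li; have li' : (i < #|{: A}|)%N.
  by rewrite -(size_codom (@equation_pair n)) codom_equation_pair.
exists (enum_val (Ordinal li')); rewrite /equation_pair enum_valK; split=> //.
exact: set_nth_default.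
Qed.

Lemma lam_equation p : p \in lam_pairs n ->
  exists k : A, (enum_rank k < size (lam_pairs n))%N /\ equation_pair k = p.
Proof.
move=> pl; have lt : (index p (lam_pairs n) < size (lam_pairs n))%N by rewrite index_mem.
have [|k [ki kp]] := @equation_index p (index p (lam_pairs n)).
  by rewrite size_cat ltn_addr.
by exists k; rewrite ki kp nth_cat lt nth_index.
Qed.

Lemma lt_equation p : p \in lt_pairs n ->
  exists k : A, (size (lam_pairs n) <= enum_rank k)%N /\ equation_pair k = p.
Proof.
move=> pl.
have [|k [ki kp]] := @equation_index p (size (lam_pairs n) + index p (lt_pairs n)).
  by rewrite size_cat ltn_add2l index_mem.
by exists k; rewrite ki kp nth_cat ltnNge leq_addr /= addKn nth_index.
Qed.

End EquationIndex.

Section Homogeneous.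
Variables (C : comNzRingType) (A : finType) (a : A).
Local Notation P := (mpoly #|{: sphere_var A}| C).
Implicit Types (w : int) (Q : {poly P}).

Lemma weight_op1 : weight_op a (1 : P) = 0.
Proof.
have : weight_op a (1 * 1 : P) = weight_op a 1 + weight_op a 1.
  by rewrite weight_opM mulr1 mul1r.
by rewrite mulr1 => /eqP; rewrite addrC -subr_eq subrr eq_sym => /eqP.
Qed.

Lemma weight_op_sum (I : Type) (r : seq I) (f : I -> P) :
  weight_op a (\sum_(i <- r) f i) = \sum_(i <- r) weight_op a (f i).
Proof. exact: raddf_sum. Qed.

Lemma weight_opZ c (f : P) : weight_op a (c *: f) = c *: weight_op a f.
Proof. exact: linearZ. Qed.

Definition weight_homog w Q := forall b, weight_op a Q`_b = w%:~R * Q`_b.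

Lemma weight_homog1 : weight_homog 0 1.
Proof.
move=> b; rewrite coef1 mul0r; case: (b == 0%N); first exact: weight_op1.
exact: raddf0.
Qed.

Lemma weight_homogM w1 w2 Q1 Q2 :
  weight_homog w1 Q1 -> weight_homog w2 Q2 -> weight_homog (w1 + w2) (Q1 * Q2).
Proof.
move=> h1 h2 b; rewrite coefM weight_op_sum mulr_sumr; apply: eq_bigr => c _.
by rewrite weight_opM h1 h2 intrD; ring.
Qed.

Lemma weight_homog_prod (I : Type) (r : seq I) (w : I -> int) (Q : I -> {poly P}) :
    (forall i, weight_homog (w i) (Q i)) ->
  weight_homog (\sum_(i <- r) w i) (\prod_(i <- r) Q i).
Proof.
move=> h; apply: (big_ind2 weight_homog) => [|w1 Q1 w2 Q2|i _].
- exact: weight_homog1.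
- exact: weight_homogM.
exact: h.
Qed.

Lemma weight_homog_linear (a' : A) (e : bool) :
  weight_homog ((a' == a)%:R * (-1) ^+ e)
    ((cvar C (a', false, e))%:P + (cvar C (a', true, e))%:P * 'X).
Proof.
move=> b; rewrite coefD coefC coefMX coefC.
rewrite intrM rmorph_nat rmorph_sign.
by case: b => [|[|b]] /=; rewrite ?addr0 ?add0r ?mulr0 ?weight_op_var ?raddf0.
Qed.

End Homogeneous.

Section Universality.
Variables (R : realType) (n : nat) (X : 'M[R[i]%C]_n).
Local Notation C := (R[i]%C).
Local Notation A := ('I_n * 'I_n.-1)%type.
Local Notation P := (mpoly #|{: sphere_var A}| C).

Definition row_poly (e : bool) (i : 'I_n) : {poly P} :=
  \prod_(c : 'I_n.-1)
    ((cvar C ((i, c), false, e))%:P + (cvar C ((i, c), true, e))%:P * 'X).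

Lemma row_poly_weight (a : A) (e : bool) (i : 'I_n) :
  weight_homog a ((i == a.1)%:R * (-1) ^+ e) (row_poly e i).
Proof.
have -> : (i == a.1)%:R * (-1) ^+ e = \sum_(c < n.-1) ((i, c) == a)%:R * (-1) ^+ e :> int.
  rewrite -mulr_suml (bigD1 a.2) //= big1 => [|c /negbTE ca].
    by rewrite addr0; case: a => k l; rewrite xpair_eqE eqxx andbT.
  by case: a ca => k l /= ca; rewrite xpair_eqE ca andbF.
by apply: weight_homog_prod => c; exact: weight_homog_linear.
Qed.

Definition equation_matrix (k : A) : 'M[C]_n :=
  if (enum_rank k < size (lam_pairs n))%N then X else 1%:M.

(** The value [e = true], taken with the conjugate matrix, gives the formal conjugate of
    [e = false]: these two are the G and F of [borsuk_ulam]. *)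
Definition sesqui_poly (M : 'M[C]_n) (e : bool) (p : 'I_n * 'I_n) : P :=
  \sum_b \sum_c M b c *: ((row_poly e p.1)`_b * (row_poly (~~ e) p.2)`_c).

Lemma sesqui_poly_weight M (e : bool) p (a : A) : weight_op a (sesqui_poly M e p) =
  (((-1) ^+ e * ((p.1 == a.1)%:R - (p.2 == a.1)%:R) : int)%:~R) * sesqui_poly M e p.
Proof.
rewrite /sesqui_poly weight_op_sum mulr_sumr; apply: eq_bigr => b _.
rewrite weight_op_sum mulr_sumr; apply: eq_bigr => c _.
rewrite weight_opZ weight_opM !row_poly_weight -scalerAr; congr (_ *: _).
rewrite signrN !mulrN !mulrDr !intrD !mulrN !intrM !rmorphN; ring.
Qed.

Variable z : A * bool -> C.
Hypothesis zS : in_spheres z.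

Definition row_vec (i : 'I_n) : {poly C} :=
  \prod_(c : 'I_n.-1) ((z ((i, c), false))%:P + (z ((i, c), true))%:P * 'X).

Lemma eval_row_poly e i b : eval_at z (row_poly e i)`_b =
  if e then ((row_vec i)`_b)^*%C else (row_vec i)`_b.
Proof.
rewrite -coef_map /row_poly rmorph_prod /=.
under eq_bigr do rewrite rmorphD rmorphM /= !map_polyC map_polyX /= !eval_at_var.
case: e => //; rewrite -[RHS]coef_map rmorph_prod /=; congr ((polyseq _)`_b).
by apply: eq_bigr => c _; rewrite rmorphD rmorphM /= !map_polyC map_polyX.
Qed.

(** On the spheres no linear factor is zero, hence neither is their product; its degree is at most n
    - 1, so a nonzero coefficient occurs among the first n. *)
Lemma row_vec_neq0 i : exists b : 'I_n, (row_vec i)`_b != 0.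
Proof.
apply: contrapT => H.
have : row_vec i != 0.
  apply/prodf_neq0 => c _; apply/eqP => /polyP h.
  have := h 0%N; rewrite coef0 coefD coefC coefMX /= addr0 => h0.
  have := h 1%N; rewrite coef0 coefD coefC coefMX coefC /= add0r => h1.
  have := zS (i, c); rewrite h0 h1 !mul0r addr0.
  by move/eqP; rewrite eq_sym oner_eq0.
case/negP; apply/eqP/polyP => b; rewrite coef0.
have [bn|nb] := ltnP b n.
  by apply/eqP/negPn/negP => h; apply: H; exists (Ordinal bn).
apply: nth_default; apply: leq_trans (size_poly_prod_leq _ _) _.
rewrite card_ord leq_subLR; apply: (@leq_trans (\sum_(c < n.-1) 2).+1).
  rewrite ltnS; apply: leq_sum => c _.
  apply: leq_trans (size_polyD _ _) _; rewrite geq_max size_polyC.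
  apply/andP; split; first by case: (_ == _).
  by rewrite mul_polyC -[2%N](size_polyX C) size_scale_leq.
rewrite sum_nat_const card_ord; have := ltn_ord i; move: nb; clear; lia.
Qed.

Lemma eval_sesqui_poly M e p : eval_at z (sesqui_poly M e p) =
  \sum_b \sum_c M b c * (if e then ((row_vec p.1)`_b)^*%C * (row_vec p.2)`_c
    else (row_vec p.1)`_b * ((row_vec p.2)`_c)^*%C).
Proof.
rewrite rmorph_sum; apply: eq_bigr => b _; rewrite rmorph_sum; apply: eq_bigr => c _.
rewrite [LHS]mevalZ -/(eval_at z _) eval_atM !eval_row_poly.
by case: e.
Qed.

Lemma eval_sesqui_poly_conj M p :
  eval_at z (sesqui_poly (map_mx conjc M) true p) = (eval_at z (sesqui_poly M false p))^*%C.
Proof.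
etransitivity; first exact: eval_sesqui_poly.
rewrite [in RHS]eval_sesqui_poly [RHS]rmorph_sum; apply: eq_bigr => b _.
rewrite [RHS]rmorph_sum; apply: eq_bigr => c _.
by rewrite mxE /= !conjcM conjcK.
Qed.

End Universality.

Lemma Lambda_universal (R : realType) n : universal R n (Lambda n).
Proof.
split=> [|X trX]; first exact: Lambda_in_square.
pose F k := sesqui_poly (equation_matrix X k) false (equation_pair k).
pose G k := sesqui_poly (map_mx conjc (equation_matrix X k)) true (equation_pair k).
pose w (k a : 'I_n * 'I_n.-1) := equation_weight k a.1.
have wF k a : weight_op a (F k) = (w k a)%:~R * F k.
  by rewrite sesqui_poly_weight mul1r.
have wG k a : weight_op a (G k) = - (w k a)%:~R * G k.
  by rewrite sesqui_poly_weight mulN1r rmorphN.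
have GF k z : eval_at z (G k) = (eval_at z (F k))^*%C.
  exact: eval_sesqui_poly_conj.
have [z zS zF] := borsuk_ulam wF wG GF (permanent_neq0 n R[i]%C).
pose V : 'M[R[i]%C]_n := \matrix_(i, b) (row_vec z i)`_b.
have FE k : eval_at z (F k) =
    (V *m equation_matrix X k *m map_mx Num.conj V^T) (equation_pair k).1 (equation_pair k).2.
  rewrite eval_sesqui_poly form_entry; apply: eq_bigr => b _; apply: eq_bigr => c _.
  by rewrite !mxE.
have V0 i : exists b, V i b != 0.
  by have [b b0] := row_vec_neq0 zS i; exists b; rewrite mxE.
have VV (i j : 'I_n) : (i < j)%N -> (V *m map_mx Num.conj V^T) i j = 0.
  move=> ij; have [|k [kl kE]] := @lt_equation n (i, j).
    by rewrite mem_filter mem_enum /= ij.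
  by have := FE k; rewrite zF kE /equation_matrix ltnNge kl /= mulmx1 => <-.
have [r rU] := gram_normalize V0 VV.
set U := diag_mx r *m V in rU.
exists (U *m X *m map_mx Num.conj U^T); last by exists U.
split; first by rewrite /L tr_unitary.
move=> i j; rewrite mem_Lambda => /and3P[_ _ ij].
have [|k [kl kE]] := @lam_equation n (i, j); first by rewrite mem_filter mem_enum andbT.
have := FE k; rewrite zF kE /equation_matrix kl /= => Vij.
(* Normalizing the rows only rescales each entry of the transformed matrix, so the zeros prescribed
   by the pattern persist. *)
rewrite /U trmx_mul map_mxM tr_diag_mx map_diag_mx -!mulmxA mul_diag_mx mxE !mulmxA.
by rewrite mul_mx_diag mxE -Vij mul0r mulr0.
Qed.

Theorem theorem5p1 (R : realType) (n : nat) (hn : (1 <= n)%N) :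
  (let s := ((n + 1) %/ 4)%N in
   inner (chi_pattern R (Lambda n)) (chi R n) =
     (-1) ^+ s * (n`!%:R / 2 ^+ s)) /\
  universal R n (Lambda n).
Proof. by split; [exact: inner_Lambda|exact: Lambda_universal]. Qed.
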